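(* Let $1\le p<\infty$, let $p'$ be the conjugate exponent ($\frac1p+\frac1{p'}=1$), and let $v,w$ be weights on $\mathbb{R}^n$. Let $X$ be a Banach function space on $\mathbb{R}^n$ (with Lebesgue measure) such that the weighted space $X_w$ is $p$-convex with $p$-convexity constant $M$. For measurable $f\ge 0$ put $Hf(x)=\int_{|y|<|x|}f(y)\,dy$, $x\in\mathbb{R}^n$. For $\alpha\in(0,1)$ define $$A(\alpha)=\sup_{t>0}\left(\int_{|y|<t}[v(y)]^{-p'}\,dy\right)^{\frac{\alpha}{p'}}\left\|\chi_{\{|z|>t\}}(\cdot)\left(\int_{|y|<|\cdot|}[v(y)]^{-p'}\,dy\right)^{\frac{1-\alpha}{p'}}\right\|_{X_w}.$$ Then, for every $\alpha\in(0,1)$, there is a finite constant $C>0$ such that $$\|Hf\|_{X_w}\le C\,\|f\|_{L_{p,v}}\quad\text{for every measurable } f\ge 0$$ if and only if $A(\alpha)<\infty$. Moreover, if $C>0$ is the best possible constant in this inequality, then $$\sup_{0<\alpha<1}\frac{p'\,A(\alpha)}{(1-\alpha)\left[\left(\frac{p'}{1-\alpha}\right)^{p}+\frac{1}{\alpha(p-1)}\right]^{1/p}}\le C\le M\inf_{0<\alpha<1}\frac{A(\alpha)}{(1-\alpha)^{1/p'}}.$$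
   Context: A weight on $\mathbb{R}^n$ is a positive, Lebesgue measurable, a.e. finite function. $\|f\|_{L_{p,v}}=\left(\int_{\mathbb{R}^n}|f(y)v(y)|^p\,dy\right)^{1/p}$. For $p=1$ one has $p'=\infty$, and the expressions are read with the usual conventions: $\left(\int_E v^{-p'}dy\right)^{1/p'}$ means $\operatorname{ess\,sup}_{E}v^{-1}$, and the numerical factors in the estimate of $C$ are read as their limits as $p\to1+$. A Banach function space (BFS) $X$ on a complete $\sigma$-finite measure space $(\Omega,\mu)$ is a real normed space of (classes of) real-valued $\mu$-measurable functions such that: (P1) $\|f\|_X\in[0,\infty]$ is defined for every measurable $f$, $f\in X$ iff $\|f\|_X<\infty$, and $\|f\|_X=0$ iff $f=0$ a.e.; (P2) $\|f\|_X=\||f|\|_X$; (P3) $0\le f\le g$ a.e. implies $\|f\|_X\le\|g\|_X$; (P4) $0\le f_n\uparrow f$ a.e. implies $\|f_n\|_X\uparrow\|f\|_X$ (Fatou property); (P5) $\mu(E)<\infty$ implies $\|\chi_E\|_X<\infty$; (P6) for every measurable $E$ with $\mu(E)<\infty$ there is $C_E>0$ with $\int_E f\,d\mu\le C_E\|f\|_X$ for every measurable $f\ge 0$. For a weight $w$, $X_w=\{f \text{ measurable}: fw\in X\}$ with norm $\|f\|_{X_w}=\|fw\|_X$. $X_w$ is $p$-convex ($1\le p<\infty$) with constant $M>0$ if for all $m\in\mathbb{N}$ and all $f_1,\dots,f_m\in X_w$, $\left\|\left(\sum_{k=1}^m|f_k|^p\right)^{1/p}\right\|_{X_w}\le M\left(\sum_{k=1}^m\|f_k\|_{X_w}^p\right)^{1/p}$.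 *)

(* Defs.v *)
From HB Require Import structures.
From mathcomp Require Import all_boot all_order all_algebra.
From mathcomp Require Import all_classical all_reals all_analysis.
From mathcomp Require Import measurable_realfun.

Set Implicit Arguments.
Unset Strict Implicit.
Unset Printing Implicit Defensive.
Import Order.TTheory GRing.Theory Num.Theory.
Import numFieldNormedType.Exports.

Local Open Scope classical_set_scope.
Local Open Scope ring_scope.
Local Open Scope ereal_scope.

Section lebesgue_Rn.
Context (R : realType).

Definition tcons n (x : n.-tuple R * measurableTypeR R) : n.+1.-tuple R :=
  [tuple of x.2 :: x.1].

Lemma measurable_tcons n : measurable_fun [set: _] (@tcons n).
Proof. by apply: measurable_cons; [exact: measurable_snd|exact: measurable_fst]. Qed.

Definition prod_lebesgue n (mu : {measure set (n.-tuple R) -> \bar R}) :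
    set (n.+1.-tuple R) -> \bar R :=
  pushforward (mu \x lebesgue_measure) (@tcons n).

Section prod_lebesgue_measure.
Variables (n : nat) (mu : {measure set (n.-tuple R) -> \bar R}).

Let pl0 : prod_lebesgue mu set0 = 0.
Proof. by rewrite /prod_lebesgue /pushforward preimage_set0 measure0. Qed.

Let pl_ge0 A : 0 <= prod_lebesgue mu A.
Proof. exact: (measure_ge0 (mu \x lebesgue_measure)). Qed.

Let pl_sigma_additive : semi_sigma_additive (prod_lebesgue mu).
Proof.
move=> F mF tF mUF; rewrite /prod_lebesgue /pushforward preimage_bigcup.
apply: measure_semi_sigma_additive.
- by move=> k; rewrite -[X in measurable X]setTI; exact: measurable_tcons.
- apply/trivIsetP => /= i j _ _ ij; rewrite -preimage_setI.
  by move/trivIsetP : tF => /(_ _ _ _ _ ij) ->//; rewrite preimage_set0.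
- by rewrite -preimage_bigcup -[X in measurable X]setTI; exact: measurable_tcons.
Qed.

HB.instance Definition _ := isMeasure.Build _ _ _ (prod_lebesgue mu)
  pl0 pl_ge0 pl_sigma_additive.

End prod_lebesgue_measure.

(* n-fold product of the one-dimensional Lebesgue measure (Borel sets only) *)
Fixpoint borel_lebesgue n : {measure set (n.-tuple R) -> \bar R} :=
  match n with
  | 0%N => dirac [tuple]
  | m.+1 => prod_lebesgue (borel_lebesgue m)
  end.

(* R^n with the sigma-algebra of Lebesgue measurable sets, i.e., the
   Caratheodory sigma-algebra of the outer measure of borel_lebesgue *)
Definition Rn n := caratheodory_type (borel_lebesgue n)^*%mu.

Definition leb n : {measure set (Rn n) -> \bar R} :=
  @completed_measure_extension _ _ _ (borel_lebesgue n).

Lemma leb_is_complete n : measure_is_complete (leb n).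
Proof. exact: measure_is_complete_caratheodory. Qed.

Lemma borel_lebesgue_box n (A : 'I_n -> set R) :
  (forall i, measurable (A i)) ->
  measurable [set x : n.-tuple R | forall i, A i (tnth x i)] /\
  borel_lebesgue n [set x | forall i, A i (tnth x i)] =
  \prod_(i < n) lebesgue_measure (A i).
Proof.
elim: n A => [|n IHn] A mA.
  rewrite big_ord0 (_ : [set _ | _] = setT); last first.
    by apply/seteqP; split => // x _ [].
  by split => //=; rewrite diracT.
have [mB Bn] := IHn (fun i => A (lift ord0 i)) (fun i => mA _).
have mbox : measurable [set x : n.+1.-tuple R | forall i, A i (tnth x i)].
  rewrite (_ : [set _ | _] =
      \big[setI/setT]_(i < n.+1) ((fun x => tnth x i) @^-1` A i)); last first.
    apply/seteqP; split => x /=.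
      by move=> Ax; apply: (big_ind (fun B : set _ => B x)) => //= i _; exact: Ax.
    by move=> + i; rewrite (bigD1 i)//= => -[].
  apply: bigsetI_measurable => i _.
  by rewrite -[X in measurable X]setTI; exact: measurable_tnth.
split=> //=; rewrite /prod_lebesgue /pushforward.
rewrite (_ : _ @^-1` _ =
    [set x : n.-tuple R | forall i, A (lift ord0 i) (tnth x i)] `*` A ord0).
  rewrite big_ord_recl product_measure1E//; last exact: mA.
  by rewrite Bn muleC.
apply/seteqP; split => -[x r] /=.
  move=> H; split; last exact: (H ord0).
  by move=> i; have := H (lift ord0 i); rewrite tnthS.
move=> [H1 H2] i; have [->//|] := eqVneq i ord0.
by rewrite eq_sym => /unlift_some[j -> _]; rewrite tnthS; exact: H1.
Qed.

Lemma leb_sigma_finite n : sigma_finite [set: Rn n] (leb n).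
Proof.
apply: completed_measure_extension_sigma_finite.
pose I (k : nat) : set R := `[(- k%:R)%R, k%:R%R]%classic.
have mI k : measurable (I k) by exact: measurable_itv.
exists (fun k => [set x : n.-tuple R | forall i, I k (tnth x i)]).
  apply/seteqP; split => // x _.
  have [k xk] : exists k : nat, forall i, (`|tnth x i| <= k%:R)%R.
    exists (\max_(i < n) Num.bound `|tnth x i|%R)%N => i.
    apply: (@le_trans _ _ (Num.bound `|tnth x i|%R)%:R%R).
      by apply: ltW; exact: archi_boundP.
    by rewrite ler_nat; exact: leq_bigmax.
  by exists k => // i; rewrite /I /= in_itv /= -ler_norml.
move=> k; have [mB ->] := borel_lebesgue_box (fun i : 'I_n => mI k).
split => //; rewrite ltey_eq prode_fin_num// => i _.
by rewrite /I lebesgue_measure_itv /=; case: ifP.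
Qed.

End lebesgue_Rn.

Section banach_function_space.
Context d (T : measurableType d) (R : realType).

(* [bfs_norm] is total; only its values at measurable functions are
   constrained, and the space itself is {f measurable | bfs_norm f < +oo}.
   It does not distinguish a.e. equal functions, by bfs_norm_abs and
   le_bfs_norm. *)
Record BFS (mu : {measure set T -> \bar R}) := {
  bfs_norm :> (T -> R) -> \bar R ;
  bfs_norm_ge0 : forall f : T -> R, measurable_fun [set: T] f -> 0 <= bfs_norm f ;
  bfs_norm_eq0 : forall f : T -> R, measurable_fun [set: T] f ->
    bfs_norm f = 0 <-> {ae mu, forall x, f x = 0%R} ;
  bfs_normD : forall f g : T -> R, measurable_fun [set: T] f -> measurable_fun setT g ->
    bfs_norm (f \+ g)%R <= bfs_norm f + bfs_norm g ;
  bfs_normZ : forall (c : R) (f : T -> R), measurable_fun [set: T] f ->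
    bfs_norm (fun x => c * f x)%R = `|c|%:E * bfs_norm f ;
  bfs_norm_abs : forall f : T -> R, measurable_fun [set: T] f ->
    bfs_norm (fun x => `|f x|%R) = bfs_norm f ;
  le_bfs_norm : forall f g : T -> R, measurable_fun [set: T] f -> measurable_fun setT g ->
    {ae mu, forall x, (0 <= f x <= g x)%R} -> bfs_norm f <= bfs_norm g ;
  bfs_norm_fatou : forall (f_ : nat -> T -> R) (f : T -> R),
    (forall k, measurable_fun [set: T] (f_ k)) -> measurable_fun setT f ->
    {ae mu, forall x, [/\ forall k, (0 <= f_ k x)%R,
      nondecreasing_seq (f_ ^~ x) & f_ k x @[k --> \oo] --> f x]} ->
    nondecreasing_seq (bfs_norm \o f_) /\
    (bfs_norm \o f_) k @[k --> \oo] --> bfs_norm f ;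
  bfs_norm_indic : forall E : set T, measurable E -> mu E < +oo ->
    bfs_norm \1_E < +oo ;
  bfs_norm_int : forall E : set T, measurable E -> mu E < +oo ->
    exists2 C : R, (0 < C)%R &
      forall f : T -> R, measurable_fun [set: T] f -> (forall x, (0 <= f x)%R) ->
        \int[mu]_(x in E) (f x)%:E <= C%:E * bfs_norm f }.

Variable mu : {measure set T -> \bar R}.

(* The norm of an extended real-valued function: a function which is not a.e.
   finite does not belong to the space. *)
Definition bfs_enorm (X : BFS mu) (g : T -> \bar R) : \bar R :=
  if `[< {ae mu, forall x, g x \is a fin_num} >] then X (fine \o g) else +oo.

Definition weight (v : T -> \bar R) :=
  [/\ forall x, 0 < v x, measurable_fun [set: T] v &
      {ae mu, forall x, v x < +oo}].

Definition wnorm (X : BFS mu) (w f : T -> \bar R) : \bar R :=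
  bfs_enorm X (fun x => f x * w x).

Definition p_convex (X : BFS mu) (w : T -> \bar R) (p M : R) :=
  forall (m : nat) (f : 'I_m -> T -> R),
    (forall k, measurable_fun [set: T] (f k) /\ wnorm X w (EFin \o f k) < +oo) ->
    wnorm X w (fun x => ((\sum_(k < m) `|f k x| `^ p) `^ p^-1)%R%:E) <=
    M%:E * (\sum_(k < m) wnorm X w (EFin \o f k) `^ p) `^ p^-1.

End banach_function_space.

Section hardy.
Context (R : realType) (n : nat).
Local Notation Rn := (Rn R n).
Local Notation leb := (leb R n).

Definition eucl (x : Rn) : R := Num.sqrt (\sum_(i < n) tnth x i ^+ 2)%R.

Definition hardy (f : Rn -> R) (x : Rn) : \bar R :=
  \int[leb]_(y in [set y | (eucl y < eucl x)%R]) (f y)%:E.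

Definition Lpv_norm (p : R) (v : Rn -> \bar R) (f : Rn -> R) : \bar R :=
  Lnorm leb p%:E (fun y => (f y)%:E * v y).

(* (int_{|y|<t} v^{-p'})^{1/p'}, i.e., the L_{p'} norm of 1/v on the ball; for
   p = 1 we have p' = +oo and this is the essential supremum of 1/v there.
   The power (int_{|y|<t} v^{-p'})^{a/p'} is [ball_norm p v t `^ a]. *)
Definition ball_norm (p : R) (v : Rn -> \bar R) (t : R) : \bar R :=
  Lnorm leb (hoelder_conjugate p%:E)
    ((fun y => (v y)^-1) \_ [set y | (eucl y < t)%R]).

Definition hardy_A (X : BFS leb) (p : R) (v w : Rn -> \bar R) (a : R) :
    \bar R :=
  ereal_sup [set ball_norm p v t `^ a *
      wnorm X w (fun x => (\1_[set z | (t < eucl z)%R] x)%:E *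
                          ball_norm p v (eucl x) `^ (1 - a)%R)
    | t in [set t : R | (0 < t)%R]].

Definition hardy_ineq (X : BFS leb) (p : R) (v w : Rn -> \bar R) (C : R) :=
  forall f : Rn -> R, measurable_fun [set: Rn] f -> (forall x, (0 <= f x)%R) ->
    wnorm X w (hardy f) <= C%:E * Lpv_norm p v f.

Definition best_hardy_constant (X : BFS leb) (p : R) (v w : Rn -> \bar R)
    (C : R) :=
  [/\ (0 < C)%R, hardy_ineq X p v w C &
      forall C' : R, (0 < C')%R -> hardy_ineq X p v w C' -> (C <= C')%R].

End hardy.

Section factors.
Context (R : realType).
Local Open Scope ring_scope.

Definition conj_exp (q : R) : R := q / (q - 1).

(* an expression in the exponent p, read at p = 1 as its limit as p -> 1+ *)
Definition at_exponent (F : R -> R) (p : R) : R :=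
  if p == 1 then lim (F q @[q --> 1^'+]) else F p.

Definition lower_factor (a p : R) : R := at_exponent (fun q =>
  conj_exp q / ((1 - a) *
    ((conj_exp q / (1 - a)) `^ q + (a * (q - 1))^-1) `^ q^-1)) p.

Definition upper_factor (a p : R) : R := at_exponent (fun q =>
  ((1 - a) `^ (conj_exp q)^-1)^-1) p.

End factors.

(* Main.v *)
(* Let [N(t)] be the norm of [1/v] in [L_p'] of the ball of radius [t], so that
   [N^p' = V] with [V(t)] the mass of [v^-p'] on that ball when [p > 1].

   Upper bound. For [p > 1], Hoelder's inequality with the factors
   [V(|y|)^(+-a/p')] and the substitution [u = V(|y|)] give
   [Hf(x) <= (1-a)^(-1/p') V(|x|)^((1-a)/p') (int_{|y|<|x|} g)^(1/p)] with
   [g = (f v)^p V(|.|)^(a p/p')]. The norm of the right-hand side is bounded by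
   cutting the inner integral along thin spherical shells: p-convexity applies to
   the finitely many pieces, and the Fatou property removes the discretization.
   For [p = 1] the same argument works with [g = f] and no weight in [x].

   Lower bound. For [p > 1] the test function is [f = v^-p' k(|.|)], where
   [k = V^(b-1)] outside of the ball of radius [t], [k = V(t)^(b-1) / b] inside,
   and [b = (1-a)/p']; then [Hf = V(|.|)^b / b] outside of the ball. For [p = 1],
   characteristic functions give [N(t) ||chi_{|x|>t}|| <= C], and [N(|.|)^(1-a)]
   is resolved into its level sets, which are exteriors of balls. *)
Require Import Defs.
From mathcomp Require Import all_boot all_order all_algebra.
From mathcomp Require Import all_classical all_reals all_analysis.
From mathcomp Require Import measurable_realfun ess_sup_inf hoelder.
From mathcomp Require Import ring lra.
Set Implicit Arguments.
Unset Strict Implicit.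
Unset Printing Implicit Defensive.
Import Order.TTheory GRing.Theory Num.Theory.
Import numFieldNormedType.Exports.
Local Open Scope classical_set_scope.
Local Open Scope ring_scope.
Local Open Scope ereal_scope.

(** * Real inequalities and limits *)

(** The masses [V] are nondecreasing and continuous in the radius, continuity coming from the
    nullity of spheres, but they need not be differentiable. The substitution [u = V(|y|)] therefore
    compares increments: over a shell, the integral and the increment of the primitive lie between
    the same two bounds, which differ by a product of two increments, and such errors vanish under
    refinement. For [p = 1] the essential supremum [N] may jump in the radius, so the integration
    runs over the levels of [N] instead; the same comparison lemma performs it.

    [N] may a priori be infinite. Each direction excludes this first: a finite [A(a)] does so
    because the norm inside it would be infinite, the inequality does so through truncated test
    functions.

    The bracket in the lower constant is the p-th power of the weighted norm of the test function,
    up to a power of [V(t)]: [(p'/(1-a))^p = b^-p] comes from the ball, [1/(a(p-1))] from its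
    exterior, where the exponent of [V] is [- a(p-1) - 1]. The limit of the whole factor as
    [p -> 1+] is [a], the value that the separate argument for [p = 1] has to reach. *)

Section powR_tangents.
Context (R : realType).
Local Open Scope ring_scope.

Lemma powR_bernoulli_le (s b : R) : 0 < s -> 0 <= b <= 1 ->
  s `^ b <= 1 + b * (s - 1).
Proof.
move=> s0 /andP[]; rewrite le_eqVlt => /predU1P[<- _|b0 b1].
  by rewrite powRr0 mul0r addr0.
pose L := b * ln s; have sb : s `^ b = expR L by rewrite /powR gt_eqF.
(* The convex combination of [expR (- L)] and [expR (L / b - L)] with weights
   [1 - b] and [b] is at least 1, since [1 + x <= expR x]. *)
have h1 := expR_ge1Dx (- L); have h2 := expR_ge1Dx (ln s - L).
have sE : s = expR L * expR (ln s - L) by rewrite -expRD addrC subrK lnK.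
have e1 : expR L * expR (- L) = 1 by rewrite -expRD subrr expR0.
rewrite sb.
have -> : 1 + b * (s - 1) =
    expR L * ((1 - b) * expR (- L) + b * expR (ln s - L)).
  rewrite [RHS]mulrDr (mulrCA (expR L)) e1 (mulrCA (expR L)) -sE; ring.
rewrite ler_peMr ?expR_ge0//.
have : (1 - b) * (1 - L) + b * (1 + (ln s - L)) <=
    (1 - b) * expR (- L) + b * expR (ln s - L).
  by apply: lerD; apply: ler_wpM2l => //; lra.
rewrite /L; lra.
Qed.

Lemma powR_bernoulli_ge (s c : R) : 0 < s -> c <= 0 ->
  1 + c * (s - 1) <= s `^ c.
Proof.
move=> s0 c0; rewrite /powR gt_eqF//.
apply: le_trans (expR_ge1Dx (c * ln s)); rewrite lerD2l ler_wnM2l//.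
by have := @le_ln1Dx R (s - 1); rewrite (addrC 1) subrK; apply; lra.
Qed.

Lemma powR_div (x y c : R) : 0 < x -> 0 < y -> y `^ c = x `^ c * (y / x) `^ c.
Proof.
move=> x0 y0; rewrite -powRM ?ltW ?divr_gt0//.
by rewrite mulrC divfK// gt_eqF.
Qed.

Lemma powRB1 (x c : R) : 0 < x -> x `^ (c - 1) = x `^ c / x.
Proof.
by move=> x0; rewrite powRB ?powRr1 ?ltW// (gt_eqF x0) implybT.
Qed.

(** Homogeneity reduces the tangent at [x] to Bernoulli's inequality for [y / x]. Used with [x] and
    [y] in both orders, it encloses an increment of the power between the slopes at the two
    endpoints. *)
Lemma powR_tangent_ge (x y b : R) : 0 < x -> 0 < y -> 0 <= b <= 1 ->
  y `^ b <= x `^ b + b * x `^ (b - 1) * (y - x).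
Proof.
move=> x0 y0 b01; rewrite (powR_div b x0 y0) powRB1//.
have -> : x `^ b + b * (x `^ b / x) * (y - x) = x `^ b * (1 + b * (y / x - 1)).
  by field; rewrite gt_eqF.
by rewrite ler_wpM2l ?powR_ge0// powR_bernoulli_le// divr_gt0.
Qed.

Lemma powR_tangent_le (x y c : R) : 0 < x -> 0 < y -> c <= 0 ->
  x `^ c + c * x `^ (c - 1) * (y - x) <= y `^ c.
Proof.
move=> x0 y0 c0; rewrite (powR_div c x0 y0) powRB1//.
have -> : x `^ c + c * (x `^ c / x) * (y - x) = x `^ c * (1 + c * (y / x - 1)).
  by field; rewrite gt_eqF.
by rewrite ler_wpM2l ?powR_ge0// powR_bernoulli_ge// divr_gt0.
Qed.

Lemma powR_nincr (u u' c : R) : c <= 0 -> 0 < u -> u <= u' ->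
  u' `^ c <= u `^ c.
Proof.
move=> c0 u0 uu'; rewrite -[c]opprK !(powRN _ (- c)).
have u'0 : 0 < u' by exact: lt_le_trans uu'.
rewrite lef_pV2 ?posrE ?powR_gt0//.
by apply: ge0_ler_powR; rewrite ?nnegrE ?oppr_ge0//; exact: ltW.
Qed.

End powR_tangents.

Section comparison.
Context (R : realType).
Local Open Scope ring_scope.

(* Increments of [phi] that are controlled by products of increments sum up to
   O(1/N) along a partition of [V a, V b] into N equal parts. *)
Lemma le_of_small_increments (phi V k : R -> R) (a b : R) :
  a <= b ->
  (forall s s', a <= s -> s <= s' -> s' <= b -> V s <= V s') ->
  (forall s s', a <= s -> s <= s' -> s' <= b -> k s' <= k s) ->
  (forall u, V a <= u <= V b -> exists2 s, a <= s <= b & V s = u) ->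
  (forall s s', a <= s -> s <= s' -> s' <= b ->
    phi s' - phi s <= (k s - k s') * (V s' - V s)) ->
  phi b <= phi a.
Proof.
move=> ab Vnd kni Vivt incr.
have [Vab|Vab] := eqVneq (V a) (V b).
  have := incr a b (lexx _) ab (lexx _); rewrite Vab subrr mulr0; lra.
have {}Vab : V a < V b by rewrite lt_neqAle Vab Vnd.
(* Between points where [V] climbs by exactly [de], the factors [k s - k s'] telescope, so the total
   error is one increment of [k] times [de]. *)
have chain (de : R) (de0 : 0 < de) N : forall r, a <= r <= b ->
    V r - V a = N%:R * de -> phi r - phi a <= (k a - k r) * de.
  elim: N => [|N IH] r /andP[ar rb].
    rewrite mul0r => VV; apply: (le_trans (incr a r _ _ _)) => //.
    by rewrite VV mulr0; apply: mulr_ge0; [rewrite subr_ge0 kni|exact: ltW].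
  move=> VV; have VrE : V r = V a + (N%:R * de + de).
    by move: VV; rewrite -natr1 mulrDl mul1r; lra.
  have Nde : 0 <= N%:R * de by rewrite mulr_ge0// ltW.
  have Vrb : V r <= V b by exact: Vnd.
  have [|s /andP[as_ sb] Vs] := Vivt (V a + N%:R * de).
    by apply/andP; split; lra.
  have sr : s <= r.
    by rewrite leNgt; apply/negP => /ltW rs; have := Vnd r s ar rs sb; lra.
  have h1 : phi s - phi a <= (k a - k s) * de.
    by apply: IH; [rewrite as_ sb|rewrite Vs; lra].
  have := incr s r as_ sr rb; rewrite Vs VrE => h2.
  have h3 : V a + (N%:R * de + de) - (V a + N%:R * de) = de by lra.
  by rewrite h3 in h2; lra.
have kab : k b <= k a by exact: kni.
rewrite leNgt; apply/negP => phab.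
pose c := (k a - k b) * (V b - V a).
have c0 : 0 <= c by apply: mulr_ge0; rewrite subr_ge0// ltW.
have [N cN] : exists N : nat, c < N.+1%:R * (phi b - phi a).
  exists (Num.bound (c / (phi b - phi a))).
  rewrite -ltr_pdivrMr ?subr_gt0//.
  apply: (lt_trans (archi_boundP _)); last by rewrite ltr_nat.
  by rewrite divr_ge0// subr_ge0 ltW.
have de0 : 0 < (V b - V a) / N.+1%:R by rewrite divr_gt0// subr_gt0.
have := chain _ de0 N.+1 b; rewrite ab lexx mulrCA mulfV ?pnatr_eq0// mulr1.
move=> /(_ erefl erefl); rewrite mulrA ler_pdivlMr// mulrC -/c; lra.
Qed.

End comparison.

Section factors.
Context (R : realType).
Local Open Scope ring_scope.

(** With [s = Num.sqrt x], the bound [- ln s <= s^-1] gives [- 2 s <= x ln x], and [x ln x <= 0] for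
    [x <= 1]. It serves the term [(q - 1)^(q - 1)] as [q] tends to 1. *)
Lemma xlnx_cvg0 : (x * ln x : R) @[x --> 0^'+] --> (0 : R).
Proof.
have sq0 : (- (2 * Num.sqrt x) : R) @[x --> 0^'+] --> (0 : R).
  rewrite -[X in _ --> X]oppr0 -[X in _ --> - X](mulr0 2); apply: cvgN.
  apply: cvgMr; rewrite -[X in _ --> X]sqrtr0; apply: cvg_at_right_filter.
  exact: sqrt_continuous.
apply: (@squeeze_cvgr _ _ _ _ (fun x => - (2 * Num.sqrt x)) (cst 0)) => //; last exact: cvg_cst.
near=> x.
have x0 : 0 < x by near: x; exact: nbhs_right_gt.
have x1 : x <= 1 by near: x; exact: nbhs_right_le.
apply/andP; split; last by apply: mulr_ge0_le0; [exact: ltW|exact: ln_le0].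
have s0 : 0 < Num.sqrt x by rewrite sqrtr_gt0.
have xE : x = Num.sqrt x * Num.sqrt x by rewrite -expr2 sqr_sqrtr// ltW.
set s := Num.sqrt x in s0 xE *.
have : - ln s <= s^-1.
  rewrite -lnV ?posrE//; have := @le_ln1Dx R (s^-1 - 1).
  rewrite (addrC 1) subrK => h; have i0 : 0 < s^-1 by rewrite invr_gt0.
  by have := h ltac:(lra); lra.
move=> h; rewrite xE lnM ?posrE//.
have : s * s * - ln s <= s * s * s^-1 by rewrite ler_wpM2l// mulr_ge0// ltW.
by rewrite mulfK ?gt_eqF//; lra.
Unshelve. all: by end_near. Qed.

Lemma upper_factor1 (a : R) : a < 1 -> upper_factor a 1 = 1.
Proof.
move=> a1; rewrite /upper_factor /at_exponent eqxx.
apply: cvg_lim => //; apply/cvgrPdist_lt => e e0.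
have a0 : 0 < 1 - a by rewrite subr_gt0.
have : (expR ((q - 1) / q * ln (1 - a)))^-1 @[q --> 1^'+] --> (1 : R).
  rewrite -[X in _ --> X]invr1; apply: cvgV; first exact: oner_neq0.
  rewrite -[X in _ --> X]expR0; apply: continuous_cvg; first exact: continuous_expR.
  rewrite -[X in _ --> X](mul0r (ln (1 - a))); apply: cvgMl.
  rewrite -[X in _ --> X](mul0r (1 : R)^-1); apply: cvgM.
    rewrite -[X in _ --> X](subrr (1 : R)); apply: cvgB; last exact: cvg_cst.
    by apply: cvg_at_right_filter; exact: cvg_id.
  by apply: cvgV; [exact: oner_neq0|by apply: cvg_at_right_filter; exact: cvg_id].
move/cvgrPdist_lt => /(_ e e0); apply: filterS => q.
by rewrite /conj_exp invf_div /powR gt_eqF.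
Qed.

(** With [K = q' / (1 - a)] taken out of the bracket, the factor becomes
    [K / (K^q (1 + G))^(1/q) = (1 + G)^(-1/q)], where [G = a^-1 ((1 - a) / q)^q (q - 1)^(q - 1)]. As
    [q] tends to 1, [1 + G] tends to [1 + (1 - a) / a = 1 / a]. *)
Lemma lower_factor1 (a : R) : 0 < a < 1 -> lower_factor a 1 = a.
Proof.
move=> /andP[a0 a1]; rewrite /lower_factor /at_exponent eqxx.
apply: cvg_lim => //.
pose G (q : R) := a^-1 * expR (q * ln ((1 - a) / q) + (q - 1) * ln (q - 1)).
have G1 : G q @[q --> 1^'+] --> a^-1 * (1 - a).
  apply: cvgMr; rewrite -[X in _ --> X]lnK ?posrE ?subr_gt0//.
  apply: continuous_cvg; first exact: continuous_expR.
  rewrite -[X in _ --> X]addr0; apply: cvgD.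
    rewrite -[X in _ --> X]mul1r; apply: cvgM; first by apply: cvg_at_right_filter; exact: cvg_id.
    apply: continuous_cvg; first by apply: continuous_ln; rewrite subr_gt0.
    rewrite -[X in _ --> X]divr1; apply: cvgMr.
    by apply: cvgV; [exact: oner_neq0|by apply: cvg_at_right_filter; exact: cvg_id].
  have := xlnx_cvg0 => /cvgrPdist_lt h; apply/cvgrPdist_lt => e /h.
  case=> /= r r0 hr; exists r => //= q /=.
  rewrite distrC => qr q1; apply: hr; last by rewrite subr_gt0.
  by rewrite /= sub0r normrN.
have key : (expR (q^-1 * ln (1 + G q)))^-1 @[q --> 1^'+] --> a.
  rewrite -[X in _ --> X]invrK; apply: cvgV; first by rewrite invr_eq0 gt_eqF.
  have -> : a^-1 = expR (1^-1 * ln (1 + a^-1 * (1 - a))).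
    by rewrite invr1 mul1r mulrBr mulr1 mulVf ?gt_eqF// addrC subrK lnK// posrE invr_gt0.
  apply: continuous_cvg; first exact: continuous_expR.
  apply: cvgM; first by apply: cvgV; [exact: oner_neq0|by apply: cvg_at_right_filter; exact: cvg_id].
  apply: continuous_cvg.
    by apply: continuous_ln; rewrite addr_gt0// mulr_gt0 ?invr_gt0// subr_gt0.
  by apply: cvgD => //; exact: cvg_cst.
apply/cvgrPdist_lt => e e0; move/cvgrPdist_lt : key => /(_ e e0) key.
near=> q.
have q1 : 1 < q by near: q; exact: nbhs_right_gt.
suff -> : conj_exp q / ((1 - a) * ((conj_exp q / (1 - a)) `^ q + (a * (q - 1))^-1) `^ q^-1) =
  (expR (q^-1 * ln (1 + G q)))^-1 by near: q.
have q0 : 0 < q by lra.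
have q10 : 0 < q - 1 by lra.
have a10 : 0 < 1 - a by lra.
set K := conj_exp q / (1 - a).
have K0 : 0 < K by rewrite !divr_gt0.
have KG : K `^ q * (1 + G q) = K `^ q + (a * (q - 1))^-1.
  rewrite mulrDr mulr1; congr (_ + _).
  rewrite /G mulrCA invfM; congr (_ * _).
  rewrite /powR gt_eqF// -expRD -[RHS]lnK ?posrE ?invr_gt0//; congr expR.
  have -> : K = ((1 - a) / q)^-1 * (q - 1)^-1.
    by rewrite /K /conj_exp; field; rewrite !gt_eqF.
  rewrite lnM ?posrE ?invr_gt0 ?divr_gt0// !lnV ?posrE ?divr_gt0//; ring.
have G0 : 0 < G q by rewrite mulr_gt0 ?invr_gt0// expR_gt0.
rewrite -KG powRM ?powR_ge0 ?addr_ge0// ?ltW// -powRrM mulfV ?gt_eqF// powRr1 ?ltW//.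
rewrite /powR [1 + G q == 0]gt_eqF ?addr_gt0//.
set E := expR _; have E0 : 0 < E by rewrite expR_gt0.
by rewrite /K; field; rewrite !gt_eqF// divr_gt0.
Unshelve. all: by end_near. Qed.

End factors.

(** * Weighted Banach function norms *)

Section weighted_norm.
Context d (T : measurableType d) (R : realType).
Variables (mu : {measure set T -> \bar R}) (X : BFS mu) (w : T -> \bar R).
Hypothesis hw : weight mu w.

Local Notation N g := (wnorm X w (EFin \o g)).

Let W (x : T) : R := fine (w x).

Let W_ge0 x : (0 <= W x)%R.
Proof. by case: hw => w0 _ _; apply: fine_ge0; exact: ltW. Qed.

Let mW : measurable_fun setT W.
Proof. by case: hw => _ mw _; exact: measurableT_comp. Qed.

Let wE : {ae mu, forall x, w x = (W x)%:E}.
Proof.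
case: hw => w0 _; apply: filterS => x wy.
by rewrite /W fineK// ge0_fin_numE// ltW.
Qed.

Let W_gt0 : {ae mu, forall x, (0 < W x)%R}.
Proof.
apply: filterS wE => x wxE.
by case: hw => /(_ x) + _ _; rewrite wxE lte_fin.
Qed.

Let mM (g : T -> R) : measurable_fun setT g ->
  measurable_fun setT (fun x => g x * W x)%R.
Proof. by move=> mg; exact: measurable_funM. Qed.

(** The product with [w] is a.e. finite, so the norm is not +oo by convention, and the two real
    representatives agree at every point, because [fine] sends infinite values to 0 on both
    sides. *)
Lemma wnormE (g : T -> R) : N g = X (fun x => g x * W x)%R.
Proof.
rewrite /wnorm /bfs_enorm ifT; last first.
  by apply/asboolP; apply: filterS wE => x /= ->.
congr (bfs_norm X _); apply/funext => x /=.
rewrite /W; case: (w x) => [r||]//=; rewrite mulr0.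
  by rewrite mulry; case: sgrP => _; rewrite ?mul0e ?mul1e ?mulN1e.
by rewrite mulrNy; case: sgrP => _; rewrite ?mul0e ?mul1e ?mulN1e.
Qed.

Lemma wnorm_ge0 (g : T -> R) : measurable_fun setT g -> 0 <= N g.
Proof. by move=> mg; rewrite wnormE bfs_norm_ge0//; exact: mM. Qed.

Lemma le_wnorm_ae (g h : T -> R) :
  measurable_fun setT g -> measurable_fun setT h ->
  {ae mu, forall x, (0 <= g x <= h x)%R} -> N g <= N h.
Proof.
move=> mg mh gh; rewrite !wnormE; apply: le_bfs_norm; [exact: mM..|].
by apply: filterS gh => x /andP[g0 gh]; rewrite mulr_ge0//= ler_wpM2r.
Qed.

Lemma le_wnorm (g h : T -> R) :
  measurable_fun setT g -> measurable_fun setT h ->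
  (forall x, (0 <= g x <= h x)%R) -> N g <= N h.
Proof. by move=> mg mh gh; apply: le_wnorm_ae => //; exact: nearW. Qed.

Lemma wnormZ (c : R) (g : T -> R) : (0 <= c)%R -> measurable_fun setT g ->
  N (fun x => c * g x)%R = c%:E * N g.
Proof.
move=> c0 mg; rewrite !wnormE.
under [in LHS]eq_fun do rewrite -mulrA.
by rewrite (bfs_normZ X c (mM mg)) ger0_norm.
Qed.

Lemma le_wnormD (g h : T -> R) :
  measurable_fun setT g -> measurable_fun setT h ->
  N (fun x => g x + h x)%R <= N g + N h.
Proof.
move=> mg mh; rewrite !wnormE.
under [in leLHS]eq_fun do rewrite mulrDl.
exact: (bfs_normD X (mM mg) (mM mh)).
Qed.

Lemma le_wnorm_cvg (g_ : nat -> T -> R) (g : T -> R) (B : \bar R) :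
  (forall k, measurable_fun setT (g_ k)) -> measurable_fun setT g ->
  {ae mu, forall x, [/\ forall k, (0 <= g_ k x)%R,
      nondecreasing_seq (g_ ^~ x) & g_ k x @[k --> \oo] --> g x]} ->
  (forall k, N (g_ k) <= B) -> N g <= B.
Proof.
move=> mg_ mg gg gB; rewrite wnormE.
have [||//|nd cv] := @bfs_norm_fatou _ _ _ _ X (fun k x => g_ k x * W x)%R
    (fun x => g x * W x)%R.
- by move=> k; exact: mM.
- exact: mM.
- apply: filterS gg => x [g0 nd cv]; split => [k|m n mn|].
  + by rewrite mulr_ge0.
  + by rewrite ler_wpM2r//; exact: nd.
  + exact: cvgMl.
rewrite -(cvg_lim _ cv)//; apply: lime_le; first by apply/cvg_ex; eexists; exact: cv.
by apply: nearW => k; have := gB k; rewrite wnormE.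
Qed.

Lemma wnorm_eq0 (g : T -> R) : measurable_fun setT g ->
  N g = 0 -> {ae mu, forall x, g x = 0%R}.
Proof.
move=> mg; rewrite wnormE => /(bfs_norm_eq0 X (mM mg)).
apply: filterS2 W_gt0 => x W0 /eqP.
by rewrite mulf_eq0 (gt_eqF W0) orbF => /eqP.
Qed.

(** Since [w] is positive everywhere, [h * w] stays infinite on [E], and [bfs_enorm] gives +oo to
    functions that are not a.e. finite. *)
Lemma wnorm_infinite (h : T -> \bar R) (E : set T) :
  measurable E -> 0 < mu E -> (forall x, E x -> h x = +oo) ->
  wnorm X w h = +oo.
Proof.
move=> mE muE hE; rewrite /wnorm /bfs_enorm ifF//; apply/negbTE/asboolPn => H.
suff : mu E = 0 by move=> E0; rewrite E0 ltxx in muE.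
have : {ae mu, forall x, ~ E x}.
  case: (hw) => w0 _ _.
  by apply: filterS H => x + Ex; rewrite /= (hE _ Ex) gt0_mulye.
by move=> [A [mA A0 sA]]; apply: (subset_measure0 mE mA _ A0) => x Ex; exact: sA.
Qed.

Lemma wnorm_indic_gt0 (E : set T) :
  measurable E -> 0 < mu E -> 0 < N (\1_E : T -> R).
Proof.
move=> mE muE; rewrite lt_neqAle eq_sym wnorm_ge0; last exact: measurable_indic.
rewrite andbT; apply/eqP => /(wnorm_eq0 (measurable_indic mE))[A [mA A0 sA]].
suff : mu E = 0 by move=> E0; rewrite E0 ltxx in muE.
apply: (subset_measure0 mE mA _ A0) => x Ex; apply: sA => /=.
by rewrite indicE mem_set//= => /eqP; rewrite oner_eq0.
Qed.

End weighted_norm.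

(** * Radial integrals *)

Section radial.
Context d (T : measurableType d) (R : realType).
Variables (mu : {measure set T -> \bar R}) (rho : T -> R).
Hypothesis mrho : measurable_fun setT rho.

Definition rball (r : R) : set T := [set y | (rho y < r)%R].
(** Half-open, so that consecutive shells tile and a shell completes an open ball to a larger open
    ball. *)
Definition rshell (s r : R) : set T := [set y | (s <= rho y < r)%R].

Lemma measurable_rball r : measurable (rball r).
Proof.
rewrite (_ : rball r = rho @^-1` `]-oo, r[%classic).
  by rewrite -[X in measurable X]setTI; exact: mrho.
by apply/seteqP; split => y /=; rewrite in_itv.
Qed.

Lemma measurable_rshell s r : measurable (rshell s r).
Proof.
rewrite (_ : rshell s r = rho @^-1` `[s, r[%classic).
  by rewrite -[X in measurable X]setTI; exact: mrho.
by apply/seteqP; split => y /=; rewrite in_itv.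
Qed.

Lemma measurable_rho_ge s : measurable [set y | (s <= rho y)%R].
Proof.
rewrite (_ : mkset _ = rho @^-1` `[s, +oo[%classic).
  by rewrite -[X in measurable X]setTI; exact: mrho.
by apply/seteqP; split => y /=; rewrite in_itv/= ?andbT.
Qed.

Lemma measurable_rho_gt s : measurable [set y | (s < rho y)%R].
Proof.
rewrite (_ : mkset _ = rho @^-1` `]s, +oo[%classic).
  by rewrite -[X in measurable X]setTI; exact: mrho.
by apply/seteqP; split => y /=; rewrite in_itv/= ?andbT.
Qed.

Lemma rball_rshell s r : (s <= r)%R -> rball r = rball s `|` rshell s r.
Proof.
move=> sr; apply/seteqP; split => y; rewrite /rball /rshell /=.
  by move=> yr; case: (ltP (rho y) s) => ys; [left|right].
by move=> [ys|/andP[]//]; exact: lt_le_trans sr.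
Qed.

Section integrals.
Variable g : T -> R.
Hypotheses (mg : measurable_fun setT g) (g0 : forall y, (0 <= g y)%R).

Local Notation I r := (\int[mu]_(y in rball r) (g y)%:E).
Local Notation J s r := (\int[mu]_(y in rshell s r) (g y)%:E).

Let mgE (D : set T) : measurable_fun D (EFin \o g).
Proof. by apply/measurable_EFinP; exact: measurable_funTS. Qed.

Lemma rball_integral_split s r : (s <= r)%R -> I r = I s + J s r.
Proof.
move=> sr; rewrite (rball_rshell sr).
rewrite (ge0_integral_setU mu (measurable_rball s) (measurable_rshell s r) (@mgE _))//.
- by move=> y _; rewrite lee_fin.
- apply/disj_setPS => y [ys /andP[sy _]].
  by move: ys; rewrite /rball /= ltNge sy.
Qed.

Lemma rshell_integral_ge0 s r : 0 <= J s r.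
Proof. by apply: integral_ge0 => y _; rewrite lee_fin. Qed.

Lemma rball_integral_ge0 r : 0 <= I r.
Proof. by apply: integral_ge0 => y _; rewrite lee_fin. Qed.

Lemma le_rball_integral s r : (s <= r)%R -> I s <= I r.
Proof. by move=> sr; rewrite (rball_integral_split sr) leeDl// rshell_integral_ge0. Qed.

Lemma rshell_integral_split a s r : (a <= s)%R -> (s <= r)%R ->
  J a r = J a s + J s r.
Proof.
move=> as_ sr; rewrite (_ : rshell a r = rshell a s `|` rshell s r).
  rewrite (ge0_integral_setU mu (measurable_rshell a s) (measurable_rshell s r) (@mgE _))//.
  - by move=> y _; rewrite lee_fin.
  - apply/disj_setPS => y [/andP[_ +] /andP[sy _]].
    by rewrite ltNge sy.
apply/seteqP; split => y; rewrite /rshell /=.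
  by move=> /andP[ay yr]; case: (ltP (rho y) s) => ys; [left|right]; apply/andP.
move=> [] /andP[h1 h2]; apply/andP; split => //.
- exact: lt_le_trans sr.
- exact: le_trans h1.
Qed.

Lemma rball_integral_cvg (s_ : nat -> R) r :
  nondecreasing_seq s_ -> (forall k, s_ k <= r)%R ->
  (forall t, (t < r)%R -> exists k, (t < s_ k)%R) ->
  (I (s_ k)) @[k --> \oo] --> I r.
Proof.
move=> nd sr H; rewrite (_ : rball r = \bigcup_k rball (s_ k)).
  apply: ge0_nondecreasing_set_cvg_integral => //.
  - by move=> m n mn; apply/subsetPset => y /lt_le_trans; apply; exact: nd.
  - by move=> k; exact: measurable_rball.
  - by move=> k y _; rewrite lee_fin.
apply/seteqP; split => y; last by move=> [k _ /lt_le_trans]; apply; exact: sr.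
by move=> /H[k ks]; exists k.
Qed.

(** The shells with inner radius above [a] exhaust the shell minus the sphere of radius [a]. Nullity
    of that sphere thus yields continuity of the radial mass from the right. *)
Lemma rshell_integral_cvg_right a r : mu [set y | rho y = a] = 0 ->
  (J (a + k.+1%:R^-1) r) @[k --> \oo] --> J a r.
Proof.
move=> na; rewrite (_ : J a r = \int[mu]_(y in \bigcup_k rshell (a + k.+1%:R^-1) r) (g y)%:E).
  apply: ge0_nondecreasing_set_cvg_integral => //.
  - move=> m n mn; apply/subsetPset => y /andP[h1 h2]; apply/andP; split => //.
    apply: le_trans h1; rewrite lerD2l lef_pV2 ?posrE// ler_nat; exact: mn.
  - by move=> k; exact: measurable_rshell.
  - by move=> k y _; rewrite lee_fin.
have sa : measurable [set y | rho y = a].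
  rewrite (_ : mkset _ = rho @^-1` [set a]) //.
  by rewrite -[X in measurable X]setTI; exact: mrho.
rewrite (@ge0_negligible_integral _ _ _ _ _ _ _ sa (measurable_rshell a r) (@mgE _) _ na); last first.
  by move=> y _; rewrite lee_fin.
congr (integral mu _ _); apply/seteqP; split => y /=.
  move=> [/andP[ay yr] /eqP ya]; have {}ay : (a < rho y)%R by rewrite lt_neqAle eq_sym ya.
  have [k hk] := ltr_add_invr ay.
  by exists k => //; apply/andP; split => //; exact: ltW.
move=> [k _ /andP[h1 h2]]; have ay : (a < rho y)%R by apply: lt_le_trans h1; rewrite ltrDl.
split; first by apply/andP; split => //; exact: ltW.
by move=> ya; rewrite ya ltxx in ay.
Qed.

End integrals.
End radial.

Definition rmass d (T : measurableType d) (R : realType)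
    (mu : {measure set T -> \bar R}) (rho g : T -> R) (r : R) : R :=
  fine (\int[mu]_(y in rball rho r) (g y)%:E).

Section radial_substitution.
Context d (T : measurableType d) (R : realType).
Variables (mu : {measure set T -> \bar R}) (rho : T -> R).
Hypothesis mrho : measurable_fun setT rho.
Hypothesis sphere0 : forall r, mu [set y | rho y = r] = 0.
Variable g : T -> R.
Hypotheses (mg : measurable_fun setT g) (g0 : forall y, (0 <= g y)%R).
Hypothesis gfin : forall r, \int[mu]_(y in rball rho r) (g y)%:E < +oo.

Local Notation V := (rmass mu rho g).

Lemma rmassE r : \int[mu]_(y in rball rho r) (g y)%:E = (V r)%:E.
Proof. by rewrite fineK// ge0_fin_numE//; exact: rball_integral_ge0. Qed.

Lemma rmass_nd : {homo V : s r / (s <= r)%R}.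
Proof. by move=> s r sr; rewrite -lee_fin -!rmassE le_rball_integral. Qed.

Let shellE s r : (s <= r)%R ->
  \int[mu]_(y in rshell rho s r) (g y)%:E = (V r - V s)%:E.
Proof.
move=> sr; have := rball_integral_split mu mrho mg g0 sr; rewrite !rmassE => h.
by rewrite EFinB h addeAC subee// add0e.
Qed.

(** The point is the supremum [s] of the radii with [V <= u]. Open balls of radius below [s] exhaust
    the ball of radius [s], so [V s <= u]; the null sphere at [s] gives continuity from the right,
    so [u <= V s]. *)
Let V_ivt a b u : (a <= b)%R -> (V a <= u <= V b)%R ->
  exists2 s, (a <= s <= b)%R & V s = u.
Proof.
move=> ab /andP[au ub].
pose S := [set s | (a <= s <= b)%R /\ (V s <= u)%R].
have Sa : S a by split => //; rewrite lexx.
have Sb : ubound S b by move=> s [/andP[]].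
set s := sup S.
have as_ : (a <= s)%R by exact: (ub_le_sup (ex_intro _ b Sb)).
have sb : (s <= b)%R by exact: ge_sup (ex_intro _ a Sa) Sb.
have below t : (t < s)%R -> (V t <= u)%R.
  by move=> /(sup_gt (ex_intro _ a Sa))[r [_ Vr] tr]; apply: le_trans Vr; exact/rmass_nd/ltW.
have above t : (s < t)%R -> (u <= V t)%R.
  move=> st; have [bt|tb] := leP b t; first by apply: le_trans ub _; exact: rmass_nd.
  rewrite leNgt; apply/negP => /ltW Vtu.
  have : (t <= s)%R.
    apply: (ub_le_sup (ex_intro _ b Sb)); split => //.
    by rewrite (ltW tb) andbT (le_trans as_)// ltW.
  by rewrite leNgt st.
exists s; first by rewrite as_.
apply/eqP; rewrite eq_le -2!lee_fin -rmassE; apply/andP; split.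
  have cl : \int[mu]_(y in rball rho (s - k.+1%:R^-1)) (g y)%:E @[k --> \oo]
      --> \int[mu]_(y in rball rho s) (g y)%:E.
    apply: rball_integral_cvg => //.
    - move=> m n mn; rewrite lerD2l lerN2 lef_pV2 ?posrE// ler_nat; exact: mn.
    - by move=> k; rewrite gerBl.
    - move=> t ts; have [k hk] := ltr_add_invr ts.
      by exists k; rewrite ltrBrDr.
  rewrite -(cvg_lim _ cl)//; apply: lime_le; first exact: cvgP cl.
  by apply: nearW => k; rewrite rmassE lee_fin below// ltrBlDr ltrDl.
have cr := rshell_integral_cvg_right mrho mg g0 (r := (s + 1)%R) (sphere0 s).
suff : \int[mu]_(y in rshell rho s (s + 1)) (g y)%:E <= (V (s + 1) - u)%:E.
  by rewrite shellE ?lerDl// rmassE !lee_fin; lra.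
rewrite -(cvg_lim _ cr)//; apply: lime_le; first exact: cvgP cr.
apply: nearW => k; rewrite shellE; last by rewrite lerD2l invf_le1// ler1n.
by rewrite lee_fin lerD2l lerN2 above// ltrDl.
Qed.

Variables (h F : R -> R).
Hypotheses (mh : measurable_fun setT h) (h0 : forall u, (0 <= h u)%R).
Hypothesis h_ni : forall u u', (0 < u)%R -> (u <= u')%R -> (h u' <= h u)%R.
Hypothesis hF : forall u u', (0 < u)%R -> (u <= u')%R ->
  (h u' * (u' - u) <= F u' - F u <= h u * (u' - u))%R.

Let f y := (h (V (rho y)) * g y)%R.

Let mf : measurable_fun setT f.
Proof.
apply: measurable_funM => //; apply: measurableT_comp => //.
by apply: measurableT_comp => //; exact: (nondecreasing_measurable measurableT rmass_nd).
Qed.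

Let f0 y : (0 <= f y)%R. Proof. by rewrite mulr_ge0. Qed.

(* The substitution [u = V (rho y)], which pushes [g mu] forward to the
   Lebesgue measure; [h] is the derivative of [F]. *)
Lemma rshell_integral_subst a b : (0 < V a)%R -> (a <= b)%R ->
  \int[mu]_(y in rshell rho a b) (h (V (rho y)) * g y)%:E = (F (V b) - F (V a))%:E.
Proof.
move=> Va0 ab.
have Vs0 s : (a <= s)%R -> (0 < V s)%R by move=> /rmass_nd; exact: lt_le_trans.
(* On the shell, [V (rho y)] lies between [V s] and [V s']. The condition [0 < V a] keeps the
   arguments of [h] positive: [powR] with a negative exponent is not monotone at 0. *)
have up s s' : (a <= s)%R -> (s <= s')%R ->
    \int[mu]_(y in rshell rho s s') (f y)%:E <= (h (V s) * (V s' - V s))%:E.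
  move=> as_ ss'; rewrite EFinM -shellE// -ge0_integralZl//; last 4 first.
  - exact: measurable_rshell.
  - by apply/measurable_EFinP; exact: measurable_funTS.
  - by move=> y _; rewrite lee_fin.
  - by rewrite lee_fin.
  apply: ge0_le_integral.
  - exact: measurable_rshell.
  - by move=> y _; rewrite lee_fin.
  - by apply/measurable_EFinP; exact: measurable_funTS.
  - apply/measurable_EFinP; apply: measurable_funTS; exact: measurable_funM.
  - move=> y /andP[sy _]; rewrite lee_fin ler_wpM2r// h_ni//; first exact: Vs0.
    exact: rmass_nd.
have low s s' : (a <= s)%R -> (s <= s')%R ->
    (h (V s') * (V s' - V s))%:E <= \int[mu]_(y in rshell rho s s') (f y)%:E.
  move=> as_ ss'; rewrite EFinM -shellE// -ge0_integralZl//; last 4 first.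
  - exact: measurable_rshell.
  - by apply/measurable_EFinP; exact: measurable_funTS.
  - by move=> y _; rewrite lee_fin.
  - by rewrite lee_fin.
  apply: ge0_le_integral.
  - exact: measurable_rshell.
  - by move=> y _; rewrite lee_fin mulr_ge0.
  - apply/measurable_EFinP; apply: measurable_funTS; exact: measurable_funM.
  - by apply/measurable_EFinP; exact: measurable_funTS.
  - move=> y /andP[sy ys']; rewrite lee_fin ler_wpM2r// h_ni//.
      by apply: Vs0; exact: le_trans sy.
    by apply: rmass_nd; exact: ltW.
have fin s s' : (a <= s)%R -> (s <= s')%R ->
    \int[mu]_(y in rshell rho s s') (f y)%:E \is a fin_num.
  move=> as_ ss'; rewrite ge0_fin_numE; last exact: rshell_integral_ge0.
  by apply: le_lt_trans (up _ _ as_ ss') _; rewrite ltry.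
pose G s := fine (\int[mu]_(y in rshell rho a s) (f y)%:E).
have GE s s' : (a <= s)%R -> (s <= s')%R ->
    \int[mu]_(y in rshell rho s s') (f y)%:E = (G s' - G s)%:E.
  move=> as_ ss'; have := rshell_integral_split mu mrho mf f0 as_ ss'.
  rewrite -[X in X = _]fineK; last by apply: fin => //; exact: le_trans ss'.
  rewrite -[X in _ = X + _]fineK; last exact: fin.
  by rewrite EFinB => ->; rewrite addeAC subee// add0e.
have Gup s s' : (a <= s)%R -> (s <= s')%R -> (G s' - G s <= h (V s) * (V s' - V s))%R.
  by move=> as_ ss'; rewrite -lee_fin -GE//; exact: up.
have Glow s s' : (a <= s)%R -> (s <= s')%R -> (h (V s') * (V s' - V s) <= G s' - G s)%R.
  by move=> as_ ss'; rewrite -lee_fin -GE//; exact: low.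
have Ga : G a = 0%R.
  apply/eqP; rewrite eq_le; apply/andP; split; last first.
    by apply: fine_ge0; exact: rshell_integral_ge0.
  rewrite -lee_fin fineK; last exact: fin.
  by apply: le_trans (up _ _ _ _) _ => //; rewrite subrr mulr0.
rewrite GE// Ga subr0; congr EFin.
pose k s := h (V s).
have hFV s s' : (a <= s)%R -> (s <= s')%R ->
  (h (V s') * (V s' - V s) <= F (V s') - F (V s) <= h (V s) * (V s' - V s))%R.
  by move=> as_ ss'; apply: hF; [exact: Vs0|exact: rmass_nd].
have k_ni s s' : (a <= s)%R -> (s <= s')%R -> (s' <= b)%R -> (k s' <= k s)%R.
  by move=> as_ ss' _; apply: h_ni; [exact: Vs0|exact: rmass_nd].
have V_nd s s' : (a <= s)%R -> (s <= s')%R -> (s' <= b)%R -> (V s <= V s')%R.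
  by move=> _ ss' _; exact: rmass_nd.
have ivt u : (V a <= u <= V b)%R -> exists2 s, (a <= s <= b)%R & V s = u.
  exact: V_ivt.
have h1 : (G b - F (V b) <= G a - F (V a))%R.
  apply: (@le_of_small_increments R (fun s => G s - F (V s)) V k a b)%R => //.
  move=> s s' as_ ss' _; have := Gup _ _ as_ ss'; have /andP[+ _] := hFV _ _ as_ ss'.
  by rewrite /k mulrBl; lra.
have h2 : (F (V b) - G b <= F (V a) - G a)%R.
  apply: (@le_of_small_increments R (fun s => F (V s) - G s) V k a b)%R => //.
  move=> s s' as_ ss' _; have := Glow _ _ as_ ss'; have /andP[_ +] := hFV _ _ as_ ss'.
  by rewrite /k mulrBl; lra.
by lra.
Qed.

End radial_substitution.

Section power_substitution.
Context d (T : measurableType d) (R : realType).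
Variables (mu : {measure set T -> \bar R}) (rho : T -> R).
Hypothesis mrho : measurable_fun setT rho.
Hypothesis sphere0 : forall r, mu [set y | rho y = r] = 0.
Variable g : T -> R.
Hypotheses (mg : measurable_fun setT g) (g0 : forall y, (0 <= g y)%R).
Hypothesis gfin : forall r, \int[mu]_(y in rball rho r) (g y)%:E < +oo.

Local Notation V := (rmass mu rho g).

Lemma rshell_integral_powR b a r : (0 < b <= 1)%R -> (0 < V a)%R -> (a <= r)%R ->
  \int[mu]_(y in rshell rho a r) (V (rho y) `^ (b - 1) * g y)%:E =
  ((V r `^ b - V a `^ b) / b)%:E.
Proof.
move=> /andP[b0 b1] Va ar.
rewrite (rshell_integral_subst (F := (fun u => u `^ b / b)%R) mrho sphere0 mg g0 gfin
  (@measurable_powR R (b - 1)))//.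
- by rewrite mulrBl.
- by move=> u; exact: powR_ge0.
- by move=> u u' u0 uu'; apply: powR_nincr => //; rewrite subr_le0.
- move=> u u' u0 uu'; have u'0 : (0 < u')%R by exact: lt_le_trans uu'.
  have b01 : (0 <= b <= 1)%R by rewrite (ltW b0).
  rewrite -mulrBl ler_pdivlMr// ler_pdivrMr//.
  have := powR_tangent_ge u0 u'0 b01; have := powR_tangent_ge u'0 u0 b01.
  by move=> h1 h2; apply/andP; split; lra.
Qed.

Lemma rshell_integral_powRN b a r : (0 < b)%R -> (0 < V a)%R -> (a <= r)%R ->
  \int[mu]_(y in rshell rho a r) (V (rho y) `^ (- b - 1) * g y)%:E =
  ((V a `^ (- b) - V r `^ (- b)) / b)%:E.
Proof.
move=> b0 Va ar.
rewrite (rshell_integral_subst (F := (fun u => - (u `^ (- b) / b))%R) mrho sphere0 mg g0 gfin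
  (@measurable_powR R (- b - 1)))//.
- by congr EFin; rewrite opprK addrC -mulrBl.
- by move=> u; exact: powR_ge0.
- by move=> u u' u0 uu'; apply: powR_nincr => //; lra.
- move=> u u' u0 uu'; have u'0 : (0 < u')%R by exact: lt_le_trans uu'.
  have -> : (- (u' `^ (- b) / b) - - (u `^ (- b) / b) = (u `^ (- b) - u' `^ (- b)) / b)%R.
    by rewrite mulrBl; lra.
  rewrite ler_pdivlMr// ler_pdivrMr//.
  have nb : (- b <= 0)%R by lra.
  have := powR_tangent_le u0 u'0 nb; have := powR_tangent_le u'0 u0 nb.
  by move=> h1 h2; apply/andP; split; lra.
Qed.

Let mVpow c : measurable_fun setT (fun y => V (rho y) `^ c * g y)%R.
Proof.
apply: measurable_funM => //.
apply: (measurableT_comp (measurable_powR _)).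
apply: measurableT_comp => //.
exact: (nondecreasing_measurable measurableT (rmass_nd mrho mg g0 gfin)).
Qed.

Let Vpow0 c y : (0 <= V (rho y) `^ c * g y)%R.
Proof. by rewrite mulr_ge0// powR_ge0. Qed.

(** The substitution requires positive mass at the inner radius, so the ball is exhausted by shells
    of inner radius [1 / (k + 1)]; the nonnegative inner term [V^b / b] is discarded. *)
Lemma rball_integral_powR b r : (forall y, (0 <= rho y)%R) ->
  (forall s, (0 < s)%R -> (0 < V s)%R) -> (0 < b <= 1)%R -> (0 < r)%R ->
  \int[mu]_(y in rball rho r) (V (rho y) `^ (b - 1) * g y)%:E <= (V r `^ b / b)%:E.
Proof.
move=> rho0 V0 b01 r0; have /andP[b0 b1] := b01.
have cr := rshell_integral_cvg_right mrho (mVpow (b - 1)) (Vpow0 (b - 1)) (r := r) (sphere0 0).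
rewrite (_ : rball rho r = rshell rho 0 r); last first.
  by apply/seteqP; split => y; rewrite /rball /rshell /= rho0.
rewrite -(cvg_lim _ cr)//; apply: lime_le; first exact: cvgP cr.
have := @near_infty_natSinv_lt R (PosNum r0); apply: filterS => k /= kr.
rewrite add0r rshell_integral_powR//; [|by apply: V0|exact: ltW].
by rewrite lee_fin ler_wpM2r ?invr_ge0 ?(ltW b0)// gerBl powR_ge0.
Qed.

(** Here the outer radius of the shell tends to infinity. The outer term [V^(-b) / b] is discarded,
    so the bound holds whether the total mass is finite or not. *)
Lemma rho_ge_integral_powRN b a : (0 < b)%R -> (0 < V a)%R ->
  \int[mu]_(y in [set y | (a <= rho y)%R]) (V (rho y) `^ (- b - 1) * g y)%:E <=
  (V a `^ (- b) / b)%:E.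
Proof.
move=> b0 Va.
have -> : [set y | (a <= rho y)%R] = \bigcup_k rshell rho a (a + k%:R).
  apply/seteqP; split => y /=; last by move=> [k _ /andP[]].
  move=> ay; exists (Num.bound (rho y - a)) => //; apply/andP; split => //.
  by rewrite -ltrBlDl archi_boundP// subr_ge0.
have cv : \int[mu]_(y in rshell rho a (a + k%:R)) (V (rho y) `^ (- b - 1) * g y)%:E
    @[k --> \oo] --> \int[mu]_(y in \bigcup_k rshell rho a (a + k%:R))
      (V (rho y) `^ (- b - 1) * g y)%:E.
  apply: ge0_nondecreasing_set_cvg_integral => //.
  - move=> m n mn; apply/subsetPset => y /andP[h1 h2]; apply/andP; split => //.
    by apply: lt_le_trans h2 _; rewrite lerD2l ler_nat; exact: mn.
  - by move=> k; exact: measurable_rshell.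
  - by move=> k; apply/measurable_EFinP; exact: measurable_funTS.
  - by move=> k y _; rewrite lee_fin.
rewrite -(cvg_lim _ cv)//; apply: lime_le; first exact: cvgP cv.
apply: nearW => k; rewrite rshell_integral_powRN// ?lerDl//.
by rewrite lee_fin ler_wpM2r ?invr_ge0 ?(ltW b0)// gerBl powR_ge0.
Qed.

End power_substitution.

Lemma le_poweR (R : realType) (c : R) (x y : \bar R) : (0 <= c)%R ->
  0 <= x -> x <= y -> x `^ c <= y `^ c.
Proof.
move=> c0 x0 xy; apply: gt0_ler_poweR => //; rewrite in_itv/= leey ?x0//=.
by rewrite (le_trans x0).
Qed.

(** The bound [u k <= l] settles [l = 0], where the sequence is constant; for [l > 0] the power is
    eventually [expR (c * ln (u k))]. *)
Lemma cvg_powR (R : realType) (u : nat -> R) (l c : R) :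
  (forall k, 0 <= u k <= l)%R -> u k @[k --> \oo] --> l ->
  (u k `^ c)%R @[k --> \oo] --> (l `^ c)%R.
Proof.
move=> ul ucvg; have l0 : (0 <= l)%R by have /andP[h1 h2] := ul 0%N; exact: le_trans h2.
have [l00|l00] := eqVneq l 0%R.
  rewrite (_ : (fun k => _) = cst (l `^ c)%R); first exact: cvg_cst.
  apply/funext => k /=; congr (_ `^ _)%R; apply/eqP.
  by have := ul k; rewrite l00 eq_le andbC.
have {}l0 : (0 < l)%R by rewrite lt_neqAle eq_sym l00.
have h : (expR (c * ln (u k)))%R @[k --> \oo] --> (expR (c * ln l))%R.
  apply: continuous_cvg; first exact: continuous_expR.
  by apply: cvgMr; apply: continuous_cvg => //; exact: continuous_ln.
rewrite [X in _ --> X](_ : _ = expR (c * ln l))%R; last by rewrite /powR gt_eqF.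
apply: cvg_trans h; apply: near_eq_cvg.
have : \forall k \near \oo, (0 < u k)%R by exact: (cvgr_gt l ucvg).
by apply: filterS => k uk; rewrite /powR gt_eqF.
Qed.

(** * A Minkowski inequality for radial kernels from p-convexity *)

Section radial_minkowski.
Context d (T : measurableType d) (R : realType).
Variables (mu : {measure set T -> \bar R}) (rho : T -> R).
Hypothesis mrho : measurable_fun setT rho.
Hypothesis rho0 : forall y, (0 <= rho y)%R.
Variables (X : BFS mu) (w : T -> \bar R) (p M : R).
Hypothesis hw : weight mu w.
Hypothesis p1 : (1 <= p)%R.
Hypothesis M0 : (0 <= M)%R.
Hypothesis hconv : p_convex X w p M.

Local Notation N g := (wnorm X w (EFin \o g)).

Variables (g G u : T -> R) (D : R -> R) (K : R).
Hypotheses (mg : measurable_fun setT g) (g0 : forall y, (0 <= g y)%R).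
Hypotheses (mG : measurable_fun setT G) (G0 : forall y, (0 <= G y)%R).
Hypotheses (mu_ : measurable_fun setT u) (u0 : forall y, (0 <= u y)%R).
Hypothesis gfin : forall r, \int[mu]_(y in rball rho r) (g y)%:E < +oo.
Hypothesis K0 : (0 <= K)%R.
Hypothesis ND : forall t, (0 < t)%R ->
  N (fun x => \1_[set z | (t < rho z)%R] x * u x)%R <= (D t)%:E.
(** A shell-wise form of [D (rho y)^p g <= K^p G]. The factor [D] is evaluated at the outer radius
    because the piece of the discretization belonging to a shell is supported outside of that
    radius. *)
Hypothesis shellD : forall s t, (0 < t)%R -> (s <= t)%R ->
  (D t `^ p)%:E * \int[mu]_(y in rshell rho s t) (g y)%:E <=
  (K `^ p)%:E * \int[mu]_(y in rshell rho s t) (G y)%:E.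

Let p0 : (0 < p)%R. Proof. exact: lt_le_trans p1. Qed.
Let pN0 : p != 0%R. Proof. by rewrite gt_eqF. Qed.

Let shell i de := \int[mu]_(y in rshell rho (i%:R * de) (i.+1%:R * de)) (g y)%:E.

Let step_le i (de : R) : (0 < de)%R -> (i%:R * de <= i.+1%:R * de)%R.
Proof. by move=> de0; rewrite ler_pM2r// ler_nat. Qed.

Let step_gt0 i (de : R) : (0 < de)%R -> (0 < i.+1%:R * de)%R.
Proof. by move=> de0; rewrite mulr_gt0. Qed.

Let shell_fin i de : (0 < de)%R -> shell i de \is a fin_num.
Proof.
move=> de0; rewrite ge0_fin_numE; last exact: rshell_integral_ge0.
apply: le_lt_trans (gfin (i.+1%:R * de)).
by rewrite (rball_integral_split mu mrho mg g0 (step_le i de0)) leeDr// rball_integral_ge0.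
Qed.

(* The shells of width [de] that lie inside the ball of radius [r] cover the ball
   of radius [r - de]. *)
Let lower_sum (de r : R) (m : nat) : (0 < de)%R ->
  (rmass mu rho g (Num.min (r - de) (m%:R * de)) <=
   \sum_(i < m) \1_[set z | (i.+1%:R * de < z)%R] r * fine (shell i de))%R.
Proof.
move=> de0; elim: m => [|m IH].
  rewrite big_ord0 mul0r /rmass (_ : rball _ _ = set0) ?integral_set0//.
  rewrite -subset0 => y; rewrite /rball /= lt_min => /andP[_].
  by rewrite ltNge rho0.
rewrite big_ord_recr/=; have [mr|rm] := ltP (m.+1%:R * de)%R r.
  have mr' : (m%:R * de < r - de)%R by move: mr; rewrite -natr1 mulrDl mul1r; lra.
  rewrite (min_idPr (ltW mr')) in IH.
  rewrite indicE mem_set// mul1r.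
  apply: (@le_trans _ _ (rmass mu rho g (m.+1%:R * de))).
    by apply: rmass_nd => //; rewrite ge_min lexx orbT.
  apply: (@le_trans _ _ (rmass mu rho g (m%:R * de) + fine (shell m de))%R).
    rewrite -lee_fin EFinD (fineK (shell_fin m de0)) -!rmassE//.
    by rewrite (rball_integral_split mu mrho mg g0 (step_le m de0)).
  by rewrite lerD2r.
rewrite indicE memNset ?mul0r ?addr0//; last by rewrite /= ltNge rm.
have rm' : (r - de <= m%:R * de)%R by move: rm; rewrite -natr1 mulrDl mul1r; lra.
move: IH; rewrite (min_idPl rm'); apply: le_trans.
by apply: rmass_nd => //; rewrite ge_min lexx.
Qed.

Let sum_shell (de : R) (m : nat) : (0 < de)%R ->
  \sum_(i < m) \int[mu]_(y in rshell rho (i%:R * de) (i.+1%:R * de)) (G y)%:E <=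
  \int[mu]_y (G y)%:E.
Proof.
move=> de0; apply: (@le_trans _ _ (\int[mu]_(y in rball rho (m%:R * de)) (G y)%:E)).
  elim: m => [|m IH]; first by rewrite big_ord0 rball_integral_ge0.
  rewrite big_ord_recr/= (rball_integral_split mu mrho mG G0 (step_le m de0)).
  exact: leeD.
apply: ge0_subset_integral => //; first exact: measurable_rball.
- exact/measurable_EFinP.
- by move=> y _; rewrite lee_fin.
Qed.

Let mchi t : measurable_fun setT (fun x => \1_[set z | (t < rho z)%R] x * u x)%R.
Proof.
apply: measurable_funM => //; apply: measurable_indic.
exact: measurable_rho_gt.
Qed.

(** The sums over shells are not monotone when the mesh shrinks, as the meshes are not nested. This
    minorant of them is monotone along the sequence used below, as the Fatou property demands. *)
Let approx de m x := (u x * rmass mu rho g (Num.min (rho x - de) (m%:R * de)) `^ p^-1)%R.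

Let mapprox de m : measurable_fun setT (approx de m).
Proof.
apply: measurable_funM => //; apply: (measurableT_comp (measurable_powR _)).
apply: (measurableT_comp (nondecreasing_measurable measurableT (rmass_nd mrho mg g0 gfin))).
apply: measurable_minr => //; exact: measurable_funB.
Qed.

(** p-convexity is applied to the pieces [f i], whose coefficients [c i] are the p-th roots of the
    shell masses: the p-th powers of the pieces then add up to [u^p] times the sum in [lower_sum],
    and the norms are controlled shell by shell through [ND] and [shellD]. *)
Let approx_bound de m : (0 < de)%R ->
  N (approx de m) <= (M * K)%:E * (\int[mu]_y (G y)%:E) `^ p^-1.
Proof.
move=> de0.
pose c (i : 'I_m) := (fine (shell i de) `^ p^-1)%R.
pose f (i : 'I_m) x := (c i * (\1_[set z | (i.+1%:R * de < rho z)%R] x * u x))%R.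
have c0 i : (0 <= c i)%R by exact: powR_ge0.
have mf i : measurable_fun setT (f i) by apply: measurable_funM => //; exact: mchi.
have f0 i x : (0 <= f i x)%R by rewrite !mulr_ge0// indicE.
have cp i : (c i `^ p = fine (shell i de))%R.
  rewrite /c -powRrM mulVf// powRr1//; apply: fine_ge0; exact: rshell_integral_ge0.
have Nf i : N (f i) <= (c i * D (i.+1%:R * de))%:E.
  by rewrite wnormZ// EFinM lee_wpmul2l ?lee_fin// ND ?step_gt0.
have Nf0 i : 0 <= N (f i) by exact: wnorm_ge0.
have Nfp i : N (f i) `^ p <= (K `^ p)%:E *
    \int[mu]_(y in rshell rho (i%:R * de) (i.+1%:R * de)) (G y)%:E.
  apply: le_trans (shellD (step_gt0 i de0) (step_le i de0)).
  have D0 : (0 <= c i * D (i.+1%:R * de))%R by rewrite -lee_fin; exact: le_trans (Nf i).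
  apply: (@le_trans _ _ ((c i * D (i.+1%:R * de))%:E `^ p)).
    by apply: le_poweR => //; exact: ltW.
  have [ci0|ci0] := eqVneq (c i) 0%R.
    by rewrite ci0 mul0r poweR0r// mule_ge0 ?rshell_integral_ge0// lee_fin powR_ge0.
  have Di0 : (0 <= D (i.+1%:R * de))%R.
    by move: D0; rewrite pmulr_rge0// lt_neqAle eq_sym ci0 c0.
  by rewrite poweR_EFin powRM// cp mulrC EFinM fineK ?shell_fin.
apply: (@le_trans _ _ (N (fun x => (\sum_(i < m) `|f i x| `^ p) `^ p^-1)%R)).
  apply: le_wnorm => [//|//||x].
    apply: (measurableT_comp (measurable_powR _)).
    apply: measurable_sum => i; apply: (measurableT_comp (measurable_powR _)).
    exact: measurableT_comp.
  rewrite mulr_ge0 ?powR_ge0//=.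
  rewrite (_ : \sum_(i < m) _ = u x `^ p * \sum_(i < m)
      \1_[set z | (i.+1%:R * de < z)%R] (rho x) * fine (shell i de))%R; last first.
    have chi0 t : (0 <= \1_[set z | (t < rho z)%R] x :> R)%R by rewrite indicE.
    rewrite mulr_sumr; apply: eq_bigr => i _; rewrite ger0_norm// /f.
    rewrite powRM ?mulr_ge0// powRM// cp [LHS]mulrC (mulrC (_ `^ p)%R) -mulrA; congr (_ * (_ * _))%R.
    rewrite !indicE (_ : (x \in _) = (rho x \in [set z | (i.+1%:R * de < z)%R])).
      by case: (_ \in _); rewrite ?powR1 ?powR0.
    by apply/idP/idP; rewrite !inE.
  rewrite powRM ?powR_ge0//; last first.
    apply: sumr_ge0 => i _; rewrite mulr_ge0 ?indicE//.
    by apply: fine_ge0; exact: rshell_integral_ge0.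
  rewrite -powRrM mulfV// powRr1// ler_wpM2l// ge0_ler_powR ?invr_ge0 ?(ltW p0)//.
  - by rewrite nnegrE; apply: fine_ge0; exact: rball_integral_ge0.
  - rewrite nnegrE; apply: sumr_ge0 => i _; rewrite mulr_ge0 ?indicE//.
    by apply: fine_ge0; exact: rshell_integral_ge0.
  - exact: lower_sum.
apply: le_trans (hconv _) _.
  by move=> i; split => //; apply: le_lt_trans (Nf i) _; rewrite ltry.
rewrite EFinM -muleA lee_wpmul2l ?lee_fin//.
have IG0 : 0 <= \int[mu]_y (G y)%:E by apply: integral_ge0 => y _; rewrite lee_fin.
apply: (@le_trans _ _ (((K `^ p)%:E * \int[mu]_y (G y)%:E) `^ p^-1)).
  apply: le_poweR; rewrite ?invr_ge0 ?(ltW p0)//.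
    by rewrite sume_ge0// => i _; exact: poweR_ge0.
  apply: (@le_trans _ _ (\sum_(i < m) (K `^ p)%:E *
      \int[mu]_(y in rshell rho (i%:R * de) (i.+1%:R * de)) (G y)%:E)).
    by apply: lee_sum => i _; exact: Nfp.
  rewrite -ge0_sume_distrr; last by move=> i _; exact: rshell_integral_ge0.
  by rewrite lee_wpmul2l ?lee_fin ?powR_ge0// sum_shell.
by rewrite poweRM// ?lee_fin ?powR_ge0// poweR_EFin -powRrM mulfV// powRr1.
Qed.

(* Minkowski's integral inequality for the kernel
   [1_{rho y < rho x} u(x) g(y)^(1/p)], whose sections in [x] have norm at most
   [D]. *)
Lemma radial_minkowski :
  N (fun x => u x * rmass mu rho g (rho x) `^ p^-1)%R <=
  (M * K)%:E * (\int[mu]_y (G y)%:E) `^ p^-1.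
Proof.
(* With mesh [1 / (k + 1)], taking [(k + 1)^2] shells reaches the radius [k + 1]; the mesh shrinks
   while the covered range grows, so the radii increase to [rho x]. *)
pose s_ (k : nat) x : R := Num.min (rho x - k.+1%:R^-1)%R ((k.+1 * k.+1)%:R * k.+1%:R^-1)%R.
have sE k : ((k.+1 * k.+1)%:R * k.+1%:R^-1 = k.+1%:R :> R)%R by rewrite natrM mulfK.
have nds x : nondecreasing_seq (s_ ^~ x).
  move=> m n mn; rewrite /s_ !sE le_min !ge_min ler_nat ltnS mn orbT andbT.
  by apply/orP; left; rewrite lerD2l lerN2 lef_pV2 ?posrE// ler_nat.
have sr k x : (s_ k x <= rho x)%R by rewrite ge_min gerBl invr_ge0 ler0n.
have mass0 r : (0 <= rmass mu rho g r)%R by apply: fine_ge0; exact: rball_integral_ge0.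
apply: (@le_wnorm_cvg _ _ _ _ X w hw (fun k => approx k.+1%:R^-1 (k.+1 * k.+1))) => //.
- apply: measurable_funM => //; apply: (measurableT_comp (measurable_powR _)).
  exact: (measurableT_comp (nondecreasing_measurable measurableT (rmass_nd mrho mg g0 gfin))).
- apply: nearW => x; split => [k|m n mn|].
  + by rewrite mulr_ge0// powR_ge0.
  + apply: ler_wpM2l; first exact: u0.
    apply: ge0_ler_powR; first by rewrite invr_ge0 ltW.
    * by rewrite nnegrE; exact: mass0.
    * by rewrite nnegrE; exact: mass0.
    * by apply: (rmass_nd mrho mg g0 gfin); exact: (nds x).
  + apply: cvgMr; apply: cvg_powR => [k|].
      by rewrite mass0/=; apply: rmass_nd => //; exact: sr.
    apply: fine_cvg; rewrite -rmassE//.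
    apply: (@rball_integral_cvg _ _ _ mu rho mrho g mg g0 (s_ ^~ x)) => // t tr.
    have [k hk] := ltr_add_invr tr.
    exists (maxn k (Num.bound `|t|)); rewrite /s_ sE lt_min; apply/andP; split.
      rewrite ltrBrDr; apply: le_lt_trans hk; rewrite lerD2l lef_pV2 ?posrE// ler_nat ltnS.
      exact: leq_maxl.
    apply: (le_lt_trans (ler_norm _)); apply: (lt_le_trans (archi_boundP (normr_ge0 _))).
    by rewrite ler_nat leqW// leq_maxr.
- by move=> k; apply: approx_bound; rewrite invr_gt0.
Qed.

End radial_minkowski.

(** * The weight v and its ball norms *)

Section inverse_weight.
Context d (T : measurableType d) (R : realType).
Variables (mu : {measure set T -> \bar R}) (v : T -> \bar R).
Hypothesis hv : weight mu v.

(* [v^-1] as a real function; since [fine +oo = 0] and [0^-1 = 0] the equality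
   [winvE] also holds where [v] is infinite. *)
Definition winv (y : T) : R := (fine (v y))^-1.

Let fine_v_ge0 y : (0 <= fine (v y))%R.
Proof. by case: hv => v0 _ _; apply: fine_ge0; exact: ltW. Qed.

Lemma winv_ge0 y : (0 <= winv y)%R.
Proof. by rewrite invr_ge0. Qed.

Lemma measurable_fine_weight : measurable_fun setT (fine \o v).
Proof. by case: hv => _ mv _; exact: measurableT_comp. Qed.

Lemma measurable_winv : measurable_fun setT winv.
Proof.
rewrite (_ : winv = fun y => fine (v y) `^ (-1))%R.
  apply: (measurableT_comp (measurable_powR _)); exact: measurable_fine_weight.
by apply/funext => y; rewrite powR_inv1.
Qed.

Lemma winvE y : (v y)^-1 = (winv y)%:E.
Proof.
rewrite /winv; case: hv => /(_ y) + _ _; case: (v y) => [r r0||//].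
  by rewrite inver gt_eqF.
by rewrite invey /= invr0.
Qed.

Lemma weight_ae : {ae mu, forall y, v y = (fine (v y))%:E /\ (0 < winv y)%R}.
Proof.
case: hv => v0 _; apply: filterS => y vy.
have vE : v y = (fine (v y))%:E by rewrite fineK// ge0_fin_numE// ltW.
by split => //; rewrite invr_gt0 -lte_fin -vE.
Qed.

Lemma Lnorm_weight (p : R) (f : T -> R) : (0 < p)%R ->
  measurable_fun setT f -> (forall y, (0 <= f y)%R) ->
  Lnorm mu p%:E (fun y => (f y)%:E * v y) =
  (\int[mu]_y ((f y * fine (v y)) `^ p)%:E) `^ p^-1.
Proof.
move=> p0 mf f0; rewrite unlock; congr (_ `^ _).
apply: ae_eq_integral => //.
- apply: (measurableT_comp (measurable_poweR _)); apply: measurableT_comp => //.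
  by apply: emeasurable_funM; [exact/measurable_EFinP|case: hv].
- apply/measurable_EFinP; apply: (measurableT_comp (measurable_powR _)).
  by apply: measurable_funM => //; exact: measurable_fine_weight.
- apply: filterS weight_ae => y [vE _] _.
  by rewrite [in LHS]vE -EFinM /= ger0_norm//; exact: mulr_ge0.
Qed.

Lemma integral_gt0_ae (D : set T) (f : T -> R) :
  measurable D -> 0 < mu D -> measurable_fun setT f -> (forall y, (0 <= f y)%R) ->
  {ae mu, forall y, (0 < f y)%R} -> 0 < \int[mu]_(y in D) (f y)%:E.
Proof.
move=> mD muD mf f0 fpos; rewrite lt_neqAle eq_sym; apply/andP; split; last first.
  by apply: integral_ge0 => y _; rewrite lee_fin.
apply/eqP => int0.
have : \int[mu]_(y in D) `|(f y)%:E| = 0.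
  by rewrite -[RHS]int0; apply: eq_integral => y _; rewrite gee0_abs// lee_fin.
move/(ae_eq_integral_abs mu mD) => H.
have {}H : {ae mu, forall y, D y -> (f y)%:E = 0}.
  by apply: H; apply/measurable_EFinP; exact: measurable_funTS.
have [A [mA A0 sA]] : {ae mu, forall y, ~ D y}.
  apply: filterS2 H fpos => y H1 H2 Dy; have := H1 Dy => /eqP.
  by rewrite eqe gt_eqF.
suff : mu D = 0 by move=> D0; rewrite D0 ltxx in muD.
by apply: (subset_measure0 mD mA _ A0) => y Dy; apply: sA => /=; exact.
Qed.

Section ball_norm.
Variable rho : T -> R.
Hypothesis mrho : measurable_fun setT rho.

Definition rball_norm (p t : R) : \bar R :=
  Lnorm mu (hoelder_conjugate p%:E) ((fun y => (v y)^-1) \_ (rball rho t)).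

Lemma rball_norm_ge0 p t : 0 <= rball_norm p t.
Proof. exact: Lnorm_ge0. Qed.

Lemma rball_normE p t : (1 < p)%R ->
  rball_norm p t =
  (\int[mu]_(y in rball rho t) (winv y `^ conj_exp p)%:E) `^ (conj_exp p)^-1.
Proof.
move=> p1; rewrite /rball_norm /conj_exp.
have -> : hoelder_conjugate p%:E = (p / (p - 1))%:E.
  rewrite /hoelder_conjugate /= eqe gt_eqF ?(lt_trans ltr01)// -EFinD inver subr_eq0 gt_eqF//.
have q0 : (0 < p / (p - 1))%R by rewrite divr_gt0 ?subr_gt0// (lt_trans ltr01).
rewrite unlock [in RHS]integral_mkcond; congr (_ `^ _); apply: eq_integral => y _.
rewrite !patchE; case: ifPn => _; last by rewrite abse0 poweR0r// gt_eqF.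
by rewrite winvE /= ger0_norm ?winv_ge0.
Qed.

(** Positivity of [mu setT] selects the essential supremum in [Lnorm] at +oo, which is handled
    through its upper bounds; outside of the ball the patched function is 0, below every
    [y >= 0]. *)
Lemma rball_norm1P t (y : \bar R) : 0 < mu setT -> 0 <= y ->
  (rball_norm 1 t <= y) <->
  {ae mu, forall x, rball rho t x -> (winv x)%:E <= y}.
Proof.
move=> muT y0; rewrite /rball_norm hoelder_conjugate1 unlock muT.
split.
  move/ess_supP; apply: filterS => x /=; rewrite patchE => + tx.
  by rewrite mem_set// winvE gee0_abs// lee_fin winv_ge0.
move=> H; apply/ess_supP; apply: filterS H => x /= H.
rewrite patchE; case: ifPn => [/set_mem/H|_]; last by rewrite abse0.
by rewrite winvE gee0_abs// lee_fin winv_ge0.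
Qed.

Lemma le_rball_norm p s t : (1 <= p)%R -> 0 < mu setT -> (s <= t)%R ->
  rball_norm p s <= rball_norm p t.
Proof.
move=> + muT st; rewrite le_eqVlt => /predU1P[<-|p1].
  apply/rball_norm1P => //; first exact: rball_norm_ge0.
  have /(rball_norm1P _ muT (rball_norm_ge0 _ _)) := lexx (rball_norm 1 t).
  by apply: filterS => x + xs; apply; exact: lt_le_trans st.
have q0 : (0 <= (conj_exp p)^-1)%R.
  by rewrite invr_ge0 divr_ge0 ?subr_ge0 ?(ltW p1)// (le_trans ler01 (ltW p1)).
rewrite !rball_normE//; apply: le_poweR => //.
  by apply: integral_ge0 => y _; rewrite lee_fin powR_ge0.
apply: le_rball_integral => //; last by move=> y; exact: powR_ge0.
by apply: (measurableT_comp (measurable_powR _)); exact: measurable_winv.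
Qed.

End ball_norm.

End inverse_weight.

Lemma hoelder_set d (T : measurableType d) (R : realType)
    (mu : {measure set T -> \bar R}) (D : set T) (f g : T -> R) (p q : R) :
  measurable D -> measurable_fun setT f -> measurable_fun setT g ->
  (forall y, (0 <= f y)%R) -> (forall y, (0 <= g y)%R) ->
  (0 < p)%R -> (0 < q)%R -> (p^-1 + q^-1 = 1)%R ->
  \int[mu]_(y in D) (f y * g y)%:E <=
  (\int[mu]_(y in D) (f y `^ p)%:E) `^ p^-1 *
  (\int[mu]_(y in D) (g y `^ q)%:E) `^ q^-1.
Proof.
move=> mD mf mg f0 g0 p0 q0 pq.
have mi (h : T -> R) : measurable_fun setT h ->
    measurable_fun setT (fun y => h y * \1_D y)%R.
  by move=> mh; apply: measurable_funM => //; exact: measurable_indic.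
have NE (h : T -> R) (r : R) : (forall y, (0 <= h y)%R) -> (0 < r)%R ->
    Lnorm mu r%:E (EFin \o (fun y => h y * \1_D y)%R) =
    (\int[mu]_(y in D) (h y `^ r)%:E) `^ r^-1.
  move=> h0 r0; rewrite unlock [in RHS]integral_mkcond; congr (_ `^ _).
  apply: eq_integral => y _; rewrite /= patchE indicE.
  case: (y \in D); first by rewrite mulr1 ger0_norm.
  by rewrite mulr0 normr0 powR0// gt_eqF.
have := hoelder mu (mi f mf) (mi g mg) p0 q0 pq.
rewrite !NE// Lnorm1; apply: le_trans.
rewrite integral_mkcond le_eqVlt; apply/orP; left; apply/eqP.
apply: eq_integral => y _; rewrite /= patchE indicE.
case: (y \in D); rewrite ?mulr1 ?mulr0 ?normr0//.
by rewrite ger0_norm// mulr_ge0.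
Qed.

(** * The Hardy operator for an abstract radial function *)

Section radial_hardy.
Context d (T : measurableType d) (R : realType).
Variables (mu : {measure set T -> \bar R}) (rho : T -> R).

(** For the Lebesgue measure and [eucl], this and the next two definitions are convertible to
    [hardy], [hardy_A] and [hardy_ineq], so the abstract results apply to the final statement
    without rewriting. *)
Definition rhardy (f : T -> R) (x : T) : \bar R :=
  \int[mu]_(y in rball rho (rho x)) (f y)%:E.

Definition rhardy_A (X : BFS mu) (p : R) (v w : T -> \bar R) (a : R) : \bar R :=
  ereal_sup [set rball_norm mu v rho p t `^ a *
      wnorm X w (fun x => (\1_[set z | (t < rho z)%R] x)%:E *
                          rball_norm mu v rho p (rho x) `^ (1 - a)%R)
    | t in [set t : R | (0 < t)%R]].

Definition rhardy_ineq (X : BFS mu) (p : R) (v w : T -> \bar R) (C : R) :=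
  forall f : T -> R, measurable_fun setT f -> (forall x, (0 <= f x)%R) ->
    wnorm X w (rhardy f) <= C%:E * Lnorm mu p%:E (fun y => (f y)%:E * v y).

End radial_hardy.

(* All that the proof uses of the Lebesgue measure and the Euclidean norm. *)
Record radial d (T : measurableType d) (R : realType)
    (mu : {measure set T -> \bar R}) (rho : T -> R) : Prop := Radial {
  radial_measurable : measurable_fun setT rho ;
  radial_ge0 : forall y, (0 <= rho y)%R ;
  radial_sphere : forall r, mu [set y | rho y = r] = 0 ;
  radial_ball_fin : forall r, mu (rball rho r) < +oo ;
  radial_ball_gt0 : forall r, (0 < r)%R -> 0 < mu (rball rho r) ;
  radial_out_gt0 : forall r, 0 < mu [set y | (r < rho y)%R] }.

Section conj_exp.
Context (R : realType).
Local Open Scope ring_scope.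

Lemma conj_exp_gt0 (p : R) : 1 < p -> 0 < conj_exp p.
Proof. by move=> p1; rewrite divr_gt0 ?subr_gt0// (lt_trans ltr01). Qed.

Lemma conj_expV (p : R) : 1 < p -> p^-1 + (conj_exp p)^-1 = 1.
Proof.
move=> p1; have p0 : 0 < p by exact: lt_trans p1.
by rewrite /conj_exp invf_div; field; rewrite gt_eqF.
Qed.

Lemma upper_factorE (a p : R) : 1 < p ->
  upper_factor a p = ((1 - a) `^ (conj_exp p)^-1)^-1.
Proof. by move=> p1; rewrite /upper_factor /at_exponent gt_eqF. Qed.

End conj_exp.

Lemma lower_factor_gt0 (R : realType) (a p : R) : (0 < a < 1)%R -> (1 <= p)%R ->
  (0 < lower_factor a p)%R.
Proof.
move=> a01; have /andP[a0 a1] := a01.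
rewrite le_eqVlt => /predU1P[<-|p1]; first by rewrite lower_factor1.
have q0 := conj_exp_gt0 p1; have a1' : (0 < 1 - a)%R by rewrite subr_gt0.
rewrite /lower_factor /at_exponent gt_eqF//.
rewrite divr_gt0// mulr_gt0// powR_gt0//; apply: addr_gt0.
  by rewrite powR_gt0// divr_gt0.
by rewrite invr_gt0 mulr_gt0// subr_gt0.
Qed.

Lemma upper_factor_gt0 (R : realType) (a p : R) : (0 < a < 1)%R -> (1 <= p)%R ->
  (0 < upper_factor a p)%R.
Proof.
move=> /andP[a0 a1]; rewrite le_eqVlt => /predU1P[<-|p1].
  by rewrite upper_factor1.
by rewrite upper_factorE// invr_gt0 powR_gt0// subr_gt0.
Qed.

Section radial_hardy_facts.
Context d (T : measurableType d) (R : realType).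
Variables (mu : {measure set T -> \bar R}) (rho : T -> R).
Hypothesis rad : radial mu rho.
Variables (v w : T -> \bar R).
Hypotheses (hv : weight mu v) (hw : weight mu w).
Variables (X : BFS mu) (p : R).
Hypothesis p1 : (1 <= p)%R.

Let mrho := radial_measurable rad.

Local Notation N t := (rball_norm mu v rho p t).

Lemma radial_setT_gt0 : 0 < mu setT.
Proof.
apply: lt_le_trans (radial_ball_gt0 rad ltr01) _.
by apply: le_measure; rewrite ?inE//; exact: measurable_rball.
Qed.

Lemma rhardyE (f : T -> R) : (forall x, (0 <= f x)%R) ->
  (forall r, \int[mu]_(y in rball rho r) (f y)%:E < +oo) ->
  rhardy mu rho f = EFin \o (fun x => rmass mu rho f (rho x)).
Proof. by move=> f0 ffin; apply/funext => x; exact: rmassE. Qed.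

Lemma measurable_rmass (f : T -> R) : measurable_fun setT f -> (forall x, (0 <= f x)%R) ->
  (forall r, \int[mu]_(y in rball rho r) (f y)%:E < +oo) ->
  measurable_fun setT (fun x => rmass mu rho f (rho x)).
Proof.
move=> mf f0 ffin; apply: measurableT_comp => //.
exact: (nondecreasing_measurable measurableT (rmass_nd mrho mf f0 ffin)).
Qed.

Lemma rball_norm_fin (a : R) : (0 < a < 1)%R -> rhardy_A rho X p v w a < +oo ->
  forall t, N t < +oo.
Proof.
move=> /andP[a0 a1] Afin t; rewrite ltNge leye_eq; apply/eqP => Nty.
have N_y s : (t <= s)%R -> N s = +oo.
  move=> ts; apply/eqP; rewrite -leye_eq -Nty.
  exact: (le_rball_norm hv mrho p1 radial_setT_gt0 ts).
pose s := Num.max t 1%R.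
have s0 : (0 < s)%R by rewrite lt_max ltr01 orbT.
have ts : (t <= s)%R by rewrite le_max lexx.
suff : +oo <= rhardy_A rho X p v w a by rewrite leye_eq => /eqP Ay; rewrite Ay in Afin.
apply: ereal_sup_ubound; exists s => //.
rewrite (N_y s ts) poweRyr ?gt_eqF// (wnorm_infinite X hw (measurable_rho_gt mrho s)
  (radial_out_gt0 rad s)) ?mulyy//.
move=> x /= sx; rewrite indicE mem_set// mul1e N_y ?poweRyr//.
  by rewrite subr_eq0 gt_eqF.
  by apply: le_trans ts _; exact: ltW.
Qed.

Lemma rhardy_A_term (a t : R) : (forall t, N t < +oo) ->
  N t `^ a * wnorm X w (fun x => (\1_[set z | (t < rho z)%R] x)%:E *
                                 N (rho x) `^ (1 - a)%R) =
  (fine (N t) `^ a)%:E * wnorm X w (EFin \o (fun x => \1_[set z | (t < rho z)%R] x *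
                                 fine (N (rho x)) `^ (1 - a))%R).
Proof.
move=> Nfin; have NE s : N s = (fine (N s))%:E.
  by rewrite fineK// ge0_fin_numE ?rball_norm_ge0.
rewrite {1}NE poweR_EFin; congr (_ * wnorm X w _).
by apply/funext => x /=; rewrite {1}NE poweR_EFin.
Qed.

Lemma rball_norm_gt0 t : (0 < t)%R -> 0 < N t.
Proof.
move=> t0; rewrite lt_neqAle eq_sym rball_norm_ge0 andbT; apply/eqP => Nt0.
have mb := measurable_rball mrho t.
have mub := radial_ball_gt0 rad t0.
move: p1 Nt0; rewrite le_eqVlt => /predU1P[<-|pgt1] Nt0.
  have /(rball_norm1P hv _ _ radial_setT_gt0 (lexx 0)) H :
    rball_norm mu v rho 1 t <= 0 by rewrite Nt0.
  have [A [mA A0 sA]] : {ae mu, forall y, ~ rball rho t y}.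
    apply: filterS2 H (weight_ae hv) => y H1 [_ H2] /H1.
    by rewrite lee_fin leNgt H2.
  suff : mu (rball rho t) = 0 by move=> D0; rewrite D0 ltxx in mub.
  by apply: (subset_measure0 mb mA _ A0) => y Dy; apply: sA => /=; exact.
have int0 : \int[mu]_(y in rball rho t) (winv v y `^ conj_exp p)%:E = 0.
  move: Nt0; rewrite (rball_normE hv rho t pgt1) => /poweR_eq0_eq0; apply.
  by apply: integral_ge0 => y _; rewrite lee_fin powR_ge0.
suff : 0 < \int[mu]_(y in rball rho t) (winv v y `^ conj_exp p)%:E.
  by rewrite int0 ltxx.
apply: integral_gt0_ae => //.
- by apply: (measurableT_comp (measurable_powR _)); exact: measurable_winv hv.
- by move=> y; exact: powR_ge0.
- by apply: filterS (weight_ae hv) => y [_ H]; exact: powR_gt0.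
Qed.

Section p_gt1.
Hypothesis pgt1 : (1 < p)%R.

Definition dual_density (y : T) : R := (winv v y `^ conj_exp p)%R.
Local Notation S := dual_density.
Local Notation V := (rmass mu rho S).

Lemma measurable_dual_density : measurable_fun setT S.
Proof. by apply: (measurableT_comp (measurable_powR _)); exact: measurable_winv hv. Qed.

Lemma dual_density_ge0 y : (0 <= S y)%R. Proof. exact: powR_ge0. Qed.

Lemma dual_density_fin : (forall t, N t < +oo) ->
  forall r, \int[mu]_(y in rball rho r) (S y)%:E < +oo.
Proof.
move=> Nfin r; have := Nfin r; rewrite (rball_normE hv rho r pgt1).
by apply: lty_poweRy; rewrite invr_eq0 gt_eqF// conj_exp_gt0.
Qed.

Lemma fine_rball_norm t : (forall t, N t < +oo) -> fine (N t) = (V t `^ (conj_exp p)^-1)%R.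
Proof.
move=> Nfin; rewrite (rball_normE hv rho t pgt1).
by rewrite (rmassE dual_density_ge0 (dual_density_fin Nfin)).
Qed.

Lemma rmass_dual_gt0 t : (forall t, N t < +oo) -> (0 < t)%R -> (0 < V t)%R.
Proof.
move=> Nfin t0; rewrite lt_neqAle eq_sym; apply/andP; split; last first.
  by apply: fine_ge0; exact: (rball_integral_ge0 _ _ dual_density_ge0).
apply/eqP => Vt0; have := rball_norm_gt0 t0.
rewrite -[X in _ < X]fineK ?ge0_fin_numE ?rball_norm_ge0// fine_rball_norm// Vt0.
by rewrite powR0 ?ltxx// invr_eq0 gt_eqF// conj_exp_gt0.
Qed.

End p_gt1.
End radial_hardy_facts.

(** * Upper bound *)

Section upper_bound.
Context d (T : measurableType d) (R : realType).
Variables (mu : {measure set T -> \bar R}) (rho : T -> R).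
Hypothesis rad : radial mu rho.
Variables (v w : T -> \bar R).
Hypotheses (hv : weight mu v) (hw : weight mu w).
Variables (X : BFS mu).

Let mrho := radial_measurable rad.
Let rho0 := radial_ge0 rad.

Variables (p M : R).
Hypotheses (p1 : (1 <= p)%R) (M0 : (0 < M)%R) (hconv : p_convex X w p M).
Variables (a A : R).
Hypotheses (a01 : (0 < a < 1)%R) (A0 : (0 < A)%R).
Hypothesis hA : rhardy_A rho X p v w a <= A%:E.

Local Notation N g := (wnorm X w (EFin \o g)).
Local Notation B t := (rball_norm mu v rho p t).

Let Bfin t : B t < +oo.
Proof.
by apply: (rball_norm_fin rad hv hw p1 a01); apply: le_lt_trans hA _; rewrite ltry.
Qed.

Let term t : (0 < t)%R ->
  (fine (B t) `^ a)%:E * N (fun x => \1_[set z | (t < rho z)%R] x *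
                             fine (B (rho x)) `^ (1 - a))%R <= A%:E.
Proof.
move=> t0; rewrite -rhardy_A_term//; apply: le_trans hA.
by apply: ereal_sup_ubound; exists t.
Qed.

Let Bgt0 t : (0 < t)%R -> (0 < fine (B t))%R.
Proof. by move=> t0; rewrite fine_gt0// Bfin (rball_norm_gt0 rad hv p1). Qed.

Let Bnd : {homo (fun t => fine (B t)) : s t / (s <= t)%R}.
Proof.
move=> s t st; rewrite fine_le ?ge0_fin_numE ?rball_norm_ge0//.
exact: (le_rball_norm hv mrho p1 (radial_setT_gt0 rad) st).
Qed.

Let mchi t : measurable_fun setT (\1_[set z | (t < rho z)%R] : T -> R).
Proof. by apply: measurable_indic; exact: measurable_rho_gt. Qed.

Variable f : T -> R.
Hypotheses (mf : measurable_fun setT f) (f0 : forall y, (0 <= f y)%R).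

Let G y := ((f y * fine (v y)) `^ p)%R.
Let mG : measurable_fun setT G.
Proof.
apply: (measurableT_comp (measurable_powR _)); apply: measurable_funM => //.
exact: measurable_fine_weight hv.
Qed.
Let G0 y : (0 <= G y)%R. Proof. exact: powR_ge0. Qed.
Hypothesis Gfin : \int[mu]_y (G y)%:E < +oo.

Let Gball r : \int[mu]_(y in rball rho r) (G y)%:E <= \int[mu]_y (G y)%:E.
Proof.
apply: ge0_subset_integral => //; first exact: measurable_rball.
- exact/measurable_EFinP.
- by move=> y _; rewrite lee_fin.
Qed.

(** The role of Hoelder's inequality is played by [f <= N(t) f v] a.e. on the ball of radius [t],
    which costs no factor depending on [a]. *)
Lemma rhardy_upper_p1 : p = 1%R ->
  wnorm X w (rhardy mu rho f) <= (M * A)%:E * (\int[mu]_y (G y)%:E) `^ p^-1.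
Proof.
move=> pE.
have mB t : measurable (rball rho t) by exact: measurable_rball.
have le_fG (D : set T) t : measurable D -> D `<=` rball rho t ->
    \int[mu]_(y in D) (f y)%:E <= (fine (B t))%:E * \int[mu]_(y in D) (G y)%:E.
  move=> mD Dt; rewrite -ge0_integralZl//; last 3 first.
  - by apply/measurable_EFinP; exact: measurable_funTS.
  - by move=> y _; rewrite lee_fin.
  - by rewrite lee_fin fine_ge0// rball_norm_ge0.
  apply: ae_ge0_le_integral => //.
  - by move=> y _; rewrite lee_fin.
  - by apply/measurable_EFinP; exact: measurable_funTS.
  - by move=> y _; rewrite mule_ge0// lee_fin// fine_ge0// rball_norm_ge0.
  - apply/measurable_EFinP; apply: measurable_funM => //; exact: measurable_funTS.
  have := lexx (B t); rewrite {1}pE.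
  move/(rball_norm1P hv _ _ (radial_setT_gt0 rad) (rball_norm_ge0 _ _ _ _ _)).
  apply: filterS2 (weight_ae hv) => y [_ sy] H Dy.
  have := H (Dt _ Dy); rewrite -[X in _ <= X]fineK; last first.
    by rewrite ge0_fin_numE ?rball_norm_ge0.
  have vy0 : (0 < fine (v y))%R by rewrite -invr_gt0.
  have Gy : (G y = f y * fine (v y))%R by rewrite /G pE powRr1// mulr_ge0// ltW.
  rewrite lee_fin => sB; rewrite -EFinM lee_fin Gy.
  by rewrite mulrCA ler_peMr// -ler_pdivrMr// div1r.
have ffin r : \int[mu]_(y in rball rho r) (f y)%:E < +oo.
  apply: le_lt_trans (le_fG _ r (mB r) (@subset_refl _ _)) _.
  apply: lte_mul_pinfty; rewrite ?lee_fin ?fine_ge0 ?rball_norm_ge0//.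
  exact: le_lt_trans (Gball r) Gfin.
rewrite (rhardyE f0 ffin).
pose D t := (A / fine (B t))%R.
have := @radial_minkowski _ _ _ mu rho mrho rho0 X w p M hw p1 (ltW M0) hconv f G
  (cst 1%R) D A mf f0 mG G0 (measurable_cst _) (fun=> ler01) ffin (ltW A0).
have -> : (fun x => cst 1 x * rmass mu rho f (rho x) `^ p^-1)%R =
    (fun x => rmass mu rho f (rho x)).
  apply/funext => x; rewrite /cst mul1r pE invr1 powRr1// fine_ge0//.
  exact: rball_integral_ge0.
apply.
- move=> t t0.
  rewrite /D mulrC EFinM lee_pdivlMl ?Bgt0//.
  (* The factor [N(t)^(1-a)] is at most [N(rho x)^(1-a)] on the support of the characteristic
     function, which restores the term of [A]. *)
  rewrite [X in (X)%:E](_ : _ = (fine (B t) `^ a * fine (B t) `^ (1 - a)))%R; last first.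
    by rewrite -powRD ?subrKC ?powRr1 ?fine_ge0 ?rball_norm_ge0// (gt_eqF (Bgt0 t0)) implybT.
  apply: le_trans (term t0).
  rewrite EFinM -muleA lee_wpmul2l ?lee_fin ?powR_ge0// -wnormZ ?powR_ge0//; last first.
    exact: measurable_funM.
  apply: le_wnorm => // [||x].
  + by do 2 apply: measurable_funM => //.
  + apply: measurable_funM => //; apply: (measurableT_comp (measurable_powR _)).
    exact: (measurableT_comp (nondecreasing_measurable measurableT Bnd)).
  rewrite /cst mulr1 mulrC !mulr_ge0 ?powR_ge0 ?indicE//=.
  case: (boolP (x \in _)) => [|_]; last by rewrite !mul0r.
  rewrite inE /= => tx; rewrite !mul1r ge0_ler_powR ?nnegrE ?fine_ge0 ?rball_norm_ge0//.
    by rewrite subr_ge0 ltW; case/andP: a01.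
  by apply: Bnd; exact: ltW.
- move=> s t t0 st; rewrite pE !powRr1 ?(ltW A0) ?divr_ge0 ?fine_ge0 ?rball_norm_ge0 ?(ltW A0)//.
  rewrite /D EFinM -muleA lee_wpmul2l ?lee_fin ?(ltW A0)//.
  rewrite lee_pdivrMl ?Bgt0//; apply: le_fG.
    exact: measurable_rshell.
  by move=> y /andP[].
Qed.

Lemma rhardy_upper_pgt1 : (1 < p)%R ->
  wnorm X w (rhardy mu rho f) <=
  (M * upper_factor a p * A)%:E * (\int[mu]_y (G y)%:E) `^ p^-1.
Proof.
move=> pgt1; have /andP[a0 a1] := a01.
pose q := conj_exp p; have q0 : (0 < q)%R := conj_exp_gt0 pgt1.
have p0 : (0 < p)%R by exact: lt_trans pgt1.
pose S := dual_density v p.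
have mS : measurable_fun setT S := measurable_dual_density hv p.
have S0 y : (0 <= S y)%R by exact: dual_density_ge0.
have Sfin := dual_density_fin hv pgt1 Bfin : forall r, \int[mu]_(y in rball rho r) (S y)%:E < +oo.
pose V := rmass mu rho S.
have BV t : fine (B t) = (V t `^ q^-1)%R by exact: fine_rball_norm.
have V0 t : (0 < t)%R -> (0 < V t)%R by exact: (rmass_dual_gt0 rad hv).
have Vge0 t : (0 <= V t)%R by apply: fine_ge0; exact: (rball_integral_ge0 _ _ S0).
have ndV : {homo V : s t / (s <= t)%R} by exact: rmass_nd.
have mV c : measurable_fun setT (fun y => V (rho y) `^ c)%R.
  by apply: (measurableT_comp (measurable_powR _)); exact: measurable_rmass.
pose c := (a / q)%R; have c0 : (0 < c)%R by rewrite divr_gt0.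
pose g y := (G y * V (rho y) `^ (c * p))%R.
have mg : measurable_fun setT g by exact: measurable_funM.
have g0 y : (0 <= g y)%R by rewrite mulr_ge0// powR_ge0.
have le_gG (D : set T) t : measurable D -> D `<=` rball rho t ->
    \int[mu]_(y in D) (g y)%:E <= (V t `^ (c * p))%:E * \int[mu]_(y in D) (G y)%:E.
  move=> mD Dt; rewrite -ge0_integralZl; [|exact: mD| | |].
  2: by apply/measurable_EFinP; exact: measurable_funTS.
  2: by move=> y _; rewrite lee_fin.
  2: by rewrite lee_fin powR_ge0.
  apply: ge0_le_integral; first exact: mD.
  - by move=> y _; rewrite lee_fin.
  - by apply/measurable_EFinP; exact: measurable_funTS.
  - apply/measurable_EFinP.
    exact: (measurable_funM (measurable_cst _) (measurable_funTS mG)).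
  move=> y /Dt /ltW yt; rewrite -EFinM lee_fin /g mulrC; apply: ler_wpM2r; first exact: G0.
  by rewrite ge0_ler_powR ?nnegrE ?(ltW (mulr_gt0 c0 p0))//; exact: ndV.
have gfin r : \int[mu]_(y in rball rho r) (g y)%:E < +oo.
  apply: le_lt_trans (le_gG _ r (measurable_rball mrho r) (@subset_refl _ _)) _.
  apply: lte_mul_pinfty; rewrite ?lee_fin ?powR_ge0//.
  exact: le_lt_trans (Gball r) Gfin.
pose u x := (V (rho x) `^ ((1 - a) / q))%R.
have mu_ : measurable_fun setT u by exact: mV.
have u0 x : (0 <= u x)%R by exact: powR_ge0.
have BVpow t b : (fine (B t) `^ b = V t `^ (b / q))%R.
  by rewrite BV -powRrM mulrC.
(* [D t = A V(t)^-c] is the bound that [A] gives for the sections; its p-th power cancels the weight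
   [V^(c p)] of [g], estimated by its value at the outer radius. *)
have mink := @radial_minkowski _ _ _ mu rho mrho rho0 X w p M hw p1 (ltW M0) hconv g G
  u (fun t => A * V t `^ (- c))%R A mg g0 mG G0 mu_ u0 gfin (ltW A0).
have {}mink : N (fun x => u x * rmass mu rho g (rho x) `^ p^-1)%R <=
    (M * A)%:E * (\int[mu]_y (G y)%:E) `^ p^-1.
  apply: mink => [t t0|s t t0 st].
    have := term t0; rewrite BVpow -/c (_ : (fun x => _) =
        (fun x => \1_[set z | (t < rho z)%R] x * u x)%R); last first.
      by apply/funext => x; rewrite BVpow.
    by rewrite powRN mulrC EFinM lee_pdivlMl ?powR_gt0 ?V0.
  rewrite powRM ?(ltW A0) ?powR_ge0// EFinM -muleA lee_wpmul2l ?lee_fin ?powR_ge0//.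
  rewrite -powRrM mulNr powRN lee_pdivrMl ?powR_gt0 ?V0//; apply: le_gG.
    exact: measurable_rshell.
  by move=> y /andP[].
have hoeld r : (0 < r)%R -> \int[mu]_(y in rball rho r) (f y)%:E <=
    (upper_factor a p * (V r `^ ((1 - a) / q) * rmass mu rho g r `^ p^-1))%:E.
  move=> r0.
  pose F1 y := (f y * fine (v y) * V (rho y) `^ c)%R.
  pose F2 y := (winv v y * V (rho y) `^ (- c))%R.
  have vr0 y : (0 <= fine (v y))%R by rewrite -invr_ge0 (winv_ge0 hv y).
  have mF1 : measurable_fun setT F1.
    apply: measurable_funM => //; apply: measurable_funM => //.
    exact: measurable_fine_weight hv.
  have mF2 : measurable_fun setT F2.
    by apply: measurable_funM => //; exact: measurable_winv hv.
  have F10 y : (0 <= F1 y)%R by rewrite !mulr_ge0// powR_ge0.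
  have F20 y : (0 <= F2 y)%R by rewrite mulr_ge0 ?(winv_ge0 hv)// powR_ge0.
  have F1p y : (F1 y `^ p = g y)%R.
    by rewrite /F1 powRM ?mulr_ge0 ?powR_ge0// -powRrM.
  (* The exponent is [- c q = - a], in the form that [rball_integral_powR] takes for the power
     [1 - a]. *)
  have F2q y : (F2 y `^ q = V (rho y) `^ (1 - a - 1) * S y)%R.
    rewrite /F2 powRM ?(winv_ge0 hv) ?powR_ge0// mulrC -powRrM; congr (_ `^ _ * _)%R.
    by rewrite /c mulNr divfK ?gt_eqF//; lra.
  apply: (@le_trans _ _ (\int[mu]_(y in rball rho r) (F1 y * F2 y)%:E)).
    apply: ae_ge0_le_integral => //.
    - exact: measurable_rball.
    - by move=> y _; rewrite lee_fin.
    - by apply/measurable_EFinP; exact: measurable_funTS.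
    - by move=> y _; rewrite lee_fin mulr_ge0.
    - by apply/measurable_EFinP; apply: measurable_funTS; exact: measurable_funM.
    (* At [rho y = 0] the mass [V] vanishes and the factors with exponents [c] and [- c] do not
       cancel; this sphere is null. *)
    have sph : {ae mu, forall y, rho y != 0%R}.
      exists [set y | rho y = 0%R]; split => //.
      - rewrite (_ : mkset _ = rho @^-1` [set 0%R]) //.
        by rewrite -[X in measurable X]setTI; exact: mrho.
      - exact: radial_sphere.
      - by move=> y /= /negP; rewrite negbK => /eqP.
    apply: filterS2 (weight_ae hv) sph => y [_ sy] ry _.
    have Vy : (0 < V (rho y))%R by apply: V0; rewrite lt_neqAle eq_sym ry rho0.
    have vy0 : (fine (v y) != 0)%R by rewrite -invr_eq0 gt_eqF.
    rewrite lee_fin /F1 /F2 /winv powRN mulrACA mulfK// mulfV ?mulr1//.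
    by rewrite gt_eqF// powR_gt0.
  have mb := measurable_rball mrho r.
  apply: (le_trans (hoelder_set mu mb mF1 mF2 F10 F20 p0 q0 (conj_expV pgt1))).
  have -> : \int[mu]_(y in rball rho r) (F1 y `^ p)%:E = \int[mu]_(y in rball rho r) (g y)%:E.
    by apply: eq_integral => y _; rewrite F1p.
  have -> : \int[mu]_(y in rball rho r) (F2 y `^ q)%:E =
      \int[mu]_(y in rball rho r) (V (rho y) `^ (1 - a - 1) * S y)%:E.
    by apply: eq_integral => y _; rewrite F2q.
  rewrite (rmassE g0 gfin) poweR_EFin mulrA mulrC EFinM.
  rewrite lee_wpmul2l ?lee_fin ?powR_ge0//.
  apply: (@le_trans _ _ ((V r `^ (1 - a) / (1 - a))%:E `^ q^-1)).
    apply: le_poweR; first by rewrite invr_ge0 ltW.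
      by apply: integral_ge0 => y _; rewrite lee_fin mulr_ge0// powR_ge0.
    apply: (rball_integral_powR mrho (radial_sphere rad)) => //.
    by apply/andP; split; lra.
  rewrite poweR_EFin lee_fin upper_factorE// -/q powRM; [|exact: powR_ge0|by rewrite invr_ge0; lra].
  rewrite -powRrM mulrC ler_wpM2r ?powR_ge0//.
  by rewrite -powR_inv1 ?subr_ge0 ?(ltW a1)// -powRrM mulN1r powRN.
have ffin r : \int[mu]_(y in rball rho r) (f y)%:E < +oo.
  have r1 : (0 < Num.max r 1)%R by rewrite lt_max ltr01 orbT.
  apply: le_lt_trans (le_lt_trans (hoeld _ r1) (ltry _)).
  by apply: le_rball_integral => //; rewrite le_max lexx.
rewrite (rhardyE f0 ffin).
have uf0 : (0 <= upper_factor a p)%R by rewrite upper_factorE// invr_ge0 powR_ge0.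
have mug : measurable_fun setT (fun x => u x * rmass mu rho g (rho x) `^ p^-1)%R.
  exact: (measurable_funM mu_
    (measurableT_comp (measurable_powR _) (measurable_rmass rad mg g0 gfin))).
apply: (@le_trans _ _ (N (fun x => upper_factor a p *
    (u x * rmass mu rho g (rho x) `^ p^-1))%R)).
  apply: le_wnorm => // [||x].
  - exact: (measurable_rmass rad mf f0 ffin).
  - exact: (measurable_funM (measurable_cst _) mug).
  apply/andP; split; first by apply: fine_ge0; exact: rball_integral_ge0.
  have [rx|] := ltP 0%R (rho x).
    by rewrite -lee_fin -(rmassE f0 ffin); exact: hoeld.
  move=> rx; rewrite (_ : rmass mu rho f (rho x) = 0%R).
    by rewrite !mulr_ge0// powR_ge0.
  rewrite /rmass (_ : rball _ _ = set0) ?integral_set0//.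
  rewrite -subset0 => y; rewrite /rball /= => /lt_le_trans /(_ rx).
  by rewrite ltNge rho0.
rewrite (@wnormZ _ _ _ _ X w hw _ _ uf0 mug).
rewrite (mulrC M) -mulrA EFinM -muleA lee_wpmul2l// lee_fin.
Qed.

End upper_bound.

Lemma rhardy_ineq_upper d (T : measurableType d) (R : realType)
    (mu : {measure set T -> \bar R}) (rho : T -> R) (v w : T -> \bar R)
    (X : BFS mu) (p M a A : R) :
  radial mu rho -> weight mu v -> weight mu w -> (1 <= p)%R -> (0 < M)%R ->
  p_convex X w p M -> (0 < a < 1)%R -> (0 < A)%R -> rhardy_A rho X p v w a <= A%:E ->
  rhardy_ineq rho X p v w (M * upper_factor a p * A).
Proof.
move=> rad hv hw p1 M0 hconv a01 A0 hA f mf f0.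
have p0 : (0 < p)%R by exact: lt_le_trans p1.
have uf0 := upper_factor_gt0 a01 p1.
rewrite (Lnorm_weight hv p0 mf f0).
set I := \int[mu]_y _.
have [Iy|Iy] := eqVneq I +oo.
  by rewrite Iy poweRyr ?invr_eq0 ?gt_eqF// gt0_muley ?leey// lte_fin !mulr_gt0.
have {}Iy : I < +oo by rewrite ltey.
move: (p1); rewrite le_eqVlt => /predU1P[pE|pgt1].
  subst p; rewrite upper_factor1 ?mulr1; last by case/andP: a01.
  exact: (rhardy_upper_p1 rad hv hw p1 M0 hconv a01 A0 hA mf f0 Iy erefl).
exact: (rhardy_upper_pgt1 rad hv hw p1 M0 hconv a01 A0 hA mf f0 Iy pgt1).
Qed.

(** * Lower bound *)

Section test_functions.
Context d (T : measurableType d) (R : realType).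
Variables (mu : {measure set T -> \bar R}) (rho : T -> R).
Hypothesis rad : radial mu rho.
Variables (v w : T -> \bar R).
Hypotheses (hv : weight mu v) (hw : weight mu w).
Variables (X : BFS mu).

Let mrho := radial_measurable rad.
Let rho0 := radial_ge0 rad.

Variables (p : R).
Hypothesis p1 : (1 <= p)%R.
Variable C : R.
Hypotheses (C0 : (0 < C)%R) (hC : rhardy_ineq rho X p v w C).

Local Notation N g := (wnorm X w (EFin \o g)).
Local Notation B t := (rball_norm mu v rho p t).
Local Notation chi t := (\1_[set z | (t < rho z)%R] : T -> R).

Let p0 : (0 < p)%R. Proof. exact: lt_le_trans p1. Qed.

Let mchi t : measurable_fun setT (chi t).
Proof. by apply: measurable_indic; exact: measurable_rho_gt. Qed.

Let Nchi_gt0 t : 0 < N (chi t).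
Proof.
apply: (wnorm_indic_gt0 X hw); first exact: measurable_rho_gt.
exact: (radial_out_gt0 rad).
Qed.

Lemma rhardy_test (f h : T -> R) :
  measurable_fun setT f -> (forall y, (0 <= f y)%R) ->
  (forall r, \int[mu]_(y in rball rho r) (f y)%:E < +oo) ->
  measurable_fun setT h -> (forall x, (0 <= h x <= rmass mu rho f (rho x))%R) ->
  N h <= C%:E * (\int[mu]_y ((f y * fine (v y)) `^ p)%:E) `^ p^-1.
Proof.
move=> mf f0 ffin mh hf; rewrite -(Lnorm_weight hv p0 mf f0).
apply: le_trans (hC mf f0); rewrite (rhardyE f0 ffin).
apply: (le_wnorm X hw mh _ hf); exact: (measurable_rmass rad mf f0 ffin).
Qed.

(** The test function is the characteristic function of the part [E] of the ball where [1 / v > l].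
    Outside of the ball [Hf = mu E], while [int_E v <= mu E / l]; the common factor [mu E] cancels,
    being finite inside a ball and positive because [l] is below the essential supremum. *)
Lemma rball_norm1_chi t l : p = 1%R -> (0 < l)%R -> l%:E < B t ->
  l%:E * N (chi t) <= C%:E.
Proof.
move=> pE l0 lB.
pose E := rball rho t `&` [set y | (l < winv v y)%R].
have mb := measurable_rball mrho t.
have mw : measurable [set y | (l < winv v y)%R].
  rewrite (_ : mkset _ = winv v @^-1` `]l, +oo[%classic).
    by rewrite -[X in measurable X]setTI; exact: (measurable_winv hv).
  by apply/seteqP; split => y /=; rewrite in_itv/= ?andbT.
have mE : measurable E by exact: measurableI.
have Efin : mu E < +oo.
  by apply: le_lt_trans (radial_ball_fin rad t); apply: le_measure; rewrite ?inE//; exact: subIsetl.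
have muE0 : 0 < mu E.
  rewrite lt_neqAle measure_ge0 andbT eq_sym; apply/eqP => E0.
  move: lB; rewrite ltNge => /negP; apply; rewrite pE.
  apply/(rball_norm1P hv _ _ (radial_setT_gt0 rad)); first by rewrite lee_fin ltW.
  exists E; split => // y /= /not_implyP[ty] /negP; rewrite lee_fin -ltNge => ly.
  by split.
pose m := fine (mu E).
have mE_ : mu E = m%:E by rewrite fineK// ge0_fin_numE// measure_ge0.
have m0 : (0 < m)%R by rewrite -lte_fin -mE_.
have intE r : \int[mu]_(y in rball rho r) (\1_E y)%:E = mu (E `&` rball rho r).
  by rewrite integral_indic//; exact: measurable_rball.
have I0 y : (0 <= (\1_E : T -> R) y)%R by rewrite indicE.
have Ifin r : \int[mu]_(y in rball rho r) ((\1_E : T -> R) y)%:E < +oo.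
  rewrite intE; apply: le_lt_trans Efin; apply: le_measure; rewrite ?inE//.
  by apply: measurableI => //; exact: measurable_rball.
have mI : measurable_fun setT (\1_E : T -> R) by exact: measurable_indic.
have mh : measurable_fun setT (fun x => m * chi t x)%R.
  exact: (measurable_funM (measurable_cst _) (mchi t)).
have hh x : (0 <= m * chi t x <= rmass mu rho (\1_E : T -> R) (rho x))%R.
  rewrite mulr_ge0 ?(ltW m0) ?indicE//=.
  case: (boolP (x \in _)) => [|_]; last first.
    by rewrite mulr0; apply: fine_ge0; exact: (rball_integral_ge0 _ _ I0).
  rewrite inE /= => tx; rewrite mulr1 /rmass intE (_ : E `&` _ = E)//.
  by apply: setIidl => y [ty _]; exact: lt_trans tx.
have := rhardy_test mI I0 Ifin mh hh.
rewrite (@wnormZ _ _ _ _ X w hw _ _ (ltW m0) (mchi t)) pE invr1 poweRe1; last first.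
  by apply: integral_ge0 => y _; rewrite lee_fin powR_ge0.
have le_l : \int[mu]_y ((\1_E y * fine (v y)) `^ 1)%:E <= (l^-1 * m)%:E.
  rewrite EFinM -mE_ -[X in _ <= _ * mu X]setIT -(integral_indic mu measurableT mE).
  rewrite -ge0_integralZl//; last 2 first.
  - exact/measurable_EFinP.
  - by rewrite lee_fin invr_ge0 ltW.
  apply: ge0_le_integral => //.
  - by move=> y _; rewrite lee_fin powR_ge0.
  - apply/measurable_EFinP; apply: (measurableT_comp (measurable_powR _)).
    exact: (measurable_funM mI (measurable_fine_weight hv)).
  - by apply/measurable_EFinP; exact: (measurable_funM (measurable_cst _) mI).
  move=> y _; rewrite -EFinM lee_fin indicE.
  have [|_] := boolP (y \in E); last by rewrite mul0r mulr0 powR0.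
  rewrite inE => -[_ /= ly]; have vy0 : (0 < fine (v y))%R.
    by rewrite -invr_gt0; exact: lt_trans ly.
  by rewrite mul1r mulr1 powRr1 ?(ltW vy0)// -[leLHS]invrK lef_pV2 ?posrE ?invr_gt0// ltW.
have CE : 0 <= C%:E by rewrite lee_fin ltW.
move=> h; have {h}h := le_trans h (lee_wpmul2l CE le_l).
have : m%:E * (l%:E * N (chi t)) <= m%:E * C%:E.
  rewrite muleCA -lee_pdivlMl// (le_trans h)// -!EFinM lee_fin.
  by rewrite [leLHS](_ : _ = l^-1 * (m * C))%R//; ring.
by rewrite lee_pmul2l// lte_fin.
Qed.

(** [N (chi t)] is positive, possibly infinite, so its multiples by unbounded factors cannot stay
    below [C]. *)
Let small_chi t (F : nat -> R) : (forall M : R, exists k, (M < F k)%R) ->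
  (forall k, (0 < F k)%R -> (F k)%:E * N (chi t) <= C%:E) -> False.
Proof.
move=> Finf HF; have := Nchi_gt0 t; case E : (N (chi t)) => [e||]//.
  rewrite lte_fin => e0; have [k hk] := Finf (C / e)%R.
  have Fk : (0 < F k)%R by apply: lt_trans hk; rewrite divr_gt0.
  have := HF k Fk; rewrite E -EFinM lee_fin leNgt => /negP; apply.
  by rewrite -ltr_pdivrMr.
move=> _; have [k hk] := Finf 0%R.
by have := HF k hk; rewrite E gt0_muley ?lte_fin.
Qed.

(** The mass of [S] on balls is not yet known to be finite; on these pieces [S] is at most [k^q]. *)
Let trunc t (k : nat) : set T := rball rho t `&` [set y | (winv v y <= k%:R)%R].

Let mtrunc t k : measurable (trunc t k).
Proof.
apply: measurableI; first exact: measurable_rball.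
rewrite (_ : mkset _ = winv v @^-1` `]-oo, k%:R]%classic).
  by rewrite -[X in measurable X]setTI; exact: (measurable_winv hv).
by apply/seteqP; split => y /=; rewrite in_itv.
Qed.

Local Notation S := (dual_density v p).
Local Notation q := (conj_exp p).

(** This is [(q - 1) p = q]; where [v] is infinite, both sides are 0. *)
Lemma dual_density_weight y : (1 < p)%R -> ((S y * fine (v y)) `^ p = S y)%R.
Proof.
move=> pgt1; have q0 := conj_exp_gt0 pgt1.
rewrite /dual_density; have [s0|s0] := eqVneq (winv v y) 0%R.
  by rewrite s0 powR0 ?gt_eqF// mul0r powR0// gt_eqF.
have {}s0 : (0 < winv v y)%R by rewrite lt_neqAle eq_sym s0 (winv_ge0 hv).
have -> : fine (v y) = (winv v y `^ (-1))%R by rewrite powR_inv1 ?ltW// invrK.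
rewrite -powRD; last by rewrite (gt_eqF s0) implybT.
rewrite -powRrM; congr (_ `^ _)%R; rewrite /conj_exp; field.
by rewrite subr_eq0 gt_eqF.
Qed.

Let trunc_test t k : (1 < p)%R ->
  \int[mu]_(y in trunc t k) (S y)%:E < +oo /\
  (\int[mu]_(y in trunc t k) (S y)%:E) * N (chi t) <=
    C%:E * (\int[mu]_(y in trunc t k) (S y)%:E) `^ p^-1.
Proof.
move=> pgt1; have q0 := conj_exp_gt0 pgt1.
set D := trunc t k; have mD : measurable D := mtrunc t k.
have mS := measurable_dual_density hv p; have S0 := @dual_density_ge0 _ _ _ v p.
pose f y := (S y * \1_D y)%R.
have mI : measurable_fun setT (\1_D : T -> R) by exact: measurable_indic.
have mf : measurable_fun setT f by exact: measurable_funM mS mI.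
have f0 y : (0 <= f y)%R by rewrite mulr_ge0 ?indicE.
have fE A : measurable A -> D `<=` A ->
    \int[mu]_(y in A) (f y)%:E = \int[mu]_(y in D) (S y)%:E.
  move=> mA DA; rewrite integral_mkcond [RHS]integral_mkcond.
  apply: eq_integral => y _; rewrite !patchE /f indicE.
  have [/set_mem yD|yD] := boolP (y \in D); first by rewrite mem_set ?mulr1//; exact: DA.
  by rewrite mulr0; case: ifPn.
have Ifin : \int[mu]_(y in D) (S y)%:E < +oo.
  apply: (@le_lt_trans _ _ (\int[mu]_(y in D) (k%:R `^ q)%:E)).
    apply: ge0_le_integral => //.
    - by move=> y _; rewrite lee_fin.
    - by apply/measurable_EFinP; exact: measurable_funTS.
    - move=> y [_ /= yk]; rewrite lee_fin; apply: ge0_ler_powR => //.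
      + exact: ltW.
      + by rewrite nnegrE (winv_ge0 hv).
      + by rewrite nnegrE.
  rewrite integral_cst//; apply: lte_mul_pinfty => //.
  apply: le_lt_trans (radial_ball_fin rad t); apply: le_measure; rewrite ?inE//.
    exact: measurable_rball.
  exact: subIsetl.
split=> //.
have ffin r : \int[mu]_(y in rball rho r) (f y)%:E < +oo.
  apply: le_lt_trans Ifin; rewrite -(fE setT measurableT (@subsetT _ _)).
  apply: ge0_subset_integral => //; first exact: measurable_rball.
  - exact/measurable_EFinP.
  - by move=> y _; rewrite lee_fin.
pose m := fine (\int[mu]_(y in D) (S y)%:E).
have mE : \int[mu]_(y in D) (S y)%:E = m%:E.
  by rewrite fineK// ge0_fin_numE//; apply: integral_ge0 => y _; rewrite lee_fin.
have m0 : (0 <= m)%R by apply: fine_ge0; apply: integral_ge0 => y _; rewrite lee_fin.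
have mh : measurable_fun setT (fun x => m * chi t x)%R.
  exact: (measurable_funM (measurable_cst _) (mchi t)).
have hh x : (0 <= m * chi t x <= rmass mu rho f (rho x))%R.
  rewrite mulr_ge0 ?indicE//=.
  case: (boolP (x \in _)) => [|_]; last first.
    by rewrite mulr0; apply: fine_ge0; exact: (rball_integral_ge0 _ _ f0).
  rewrite inE /= => tx; rewrite mulr1 /rmass (fE _ (measurable_rball mrho _))//.
  by move=> y [ty _]; exact: lt_trans tx.
have := rhardy_test mf f0 ffin mh hh.
rewrite (@wnormZ _ _ _ _ X w hw _ _ m0 (mchi t)) -mE.
have -> : \int[mu]_y ((f y * fine (v y)) `^ p)%:E = \int[mu]_(y in D) (S y)%:E.
  rewrite -(fE setT measurableT (@subsetT _ _)); apply: eq_integral => y _.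
  rewrite /f indicE; case: (y \in D); first by rewrite mulr1 dual_density_weight.
  by rewrite mulr0 mul0r powR0// gt_eqF.
exact.
Qed.

(** For [p > 1], testing with [S] on the truncated ball gives [I N(chi) <= C I^(1/p)], hence
    [I^(1/q) N(chi) <= C], with [I] the truncated mass; an infinite [N] would make these masses
    unbounded. For [p = 1] every level [l] lies below an infinite [N], so [l N(chi) <= C] for all
    [l]. *)
Lemma rball_norm_lty t : B t < +oo.
Proof.
rewrite ltNge leye_eq; apply/eqP => By.
move: (p1); rewrite le_eqVlt => /predU1P[pE|pgt1].
  apply: (@small_chi t (fun k => k.+1%:R)) => [l|k k0].
    exists (Num.bound `|l|); apply: (le_lt_trans (ler_norm _)).
    by apply: lt_le_trans (archi_boundP _) _ => //; rewrite ler_nat.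
  by apply: rball_norm1_chi => //; rewrite By ltry.
have q0 := conj_exp_gt0 pgt1.
pose I k := \int[mu]_(y in trunc t k) (S y)%:E.
have IE k : I k = (fine (I k))%:E.
  have [Ifin _] := trunc_test t k pgt1.
  by rewrite fineK// ge0_fin_numE//; apply: integral_ge0 => y _; rewrite lee_fin dual_density_ge0.
apply: (@small_chi t (fun k => fine (I k) `^ q^-1)%R) => [l|k Ik]; last first.
  have {}Ik : (0 < fine (I k))%R.
    rewrite lt_neqAle eq_sym; apply/andP; split; last first.
      by apply: fine_ge0; apply: integral_ge0 => y _; rewrite lee_fin dual_density_ge0.
    by apply/eqP => I0; move: Ik; rewrite I0 powR0 ?ltxx// invr_eq0 gt_eqF.
  have [_] := trunc_test t k pgt1; rewrite -/(I k) IE poweR_EFin.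
  have pos : (0 < fine (I k) `^ p^-1)%R by rewrite powR_gt0.
  have {1}-> : fine (I k) = (fine (I k) `^ p^-1 * fine (I k) `^ q^-1)%R.
    by rewrite -powRD ?conj_expV// ?powRr1 ?(ltW Ik)// (gt_eqF Ik) implybT.
  by rewrite [X in _ <= X]muleC EFinM -muleA lee_pmul2l// lte_fin.
have cv : I k @[k --> \oo] --> \int[mu]_(y in \bigcup_k trunc t k) (S y)%:E.
  apply: ge0_nondecreasing_set_cvg_integral.
  - move=> i j ij; apply/subsetPset => y [ty /= yi]; split => //=.
    by apply: le_trans yi _; rewrite ler_nat.
  - by move=> i; exact: mtrunc.
  - by move=> i; apply/measurable_EFinP; apply: measurable_funTS; exact: measurable_dual_density hv p.
  - by move=> i y _; rewrite lee_fin dual_density_ge0.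
move: cv; rewrite (_ : \bigcup_k _ = rball rho t); last first.
  apply/seteqP; split => y; first by move=> [k _ []].
  move=> ty; exists (Num.bound (winv v y)) => //; split => //=.
  by apply/ltW/archi_boundP; exact: (winv_ge0 hv).
have -> : \int[mu]_(y in rball rho t) (S y)%:E = +oo.
  by move: By; rewrite (rball_normE hv rho t pgt1) => /poweR_eqy.
move/cvgeyPgt => /(_ (`|l| `^ q)%R)[k _ /(_ k (leqnn k))]/=.
rewrite IE lte_fin => lk; exists k; apply: (le_lt_trans (ler_norm _)).
have -> : (`|l| = (`|l| `^ q) `^ q^-1)%R.
  by rewrite -powRrM mulfV ?gt_eqF// powRr1.
apply: gt0_ltr_powR; rewrite ?invr_gt0 ?nnegrE ?powR_ge0//.
by apply: ltW; apply: le_lt_trans lk; exact: powR_ge0.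
Qed.

End test_functions.

Section lower_bound.
Context d (T : measurableType d) (R : realType).
Variables (mu : {measure set T -> \bar R}) (rho : T -> R).
Hypothesis rad : radial mu rho.
Variables (v w : T -> \bar R).
Hypotheses (hv : weight mu v) (hw : weight mu w).
Variables (X : BFS mu).

Let mrho := radial_measurable rad.
Let rho0 := radial_ge0 rad.

Variables (p : R).
Hypothesis p1 : (1 <= p)%R.
Variable C : R.
Hypotheses (C0 : (0 < C)%R) (hC : rhardy_ineq rho X p v w C).
Variable a : R.
Hypothesis a01 : (0 < a < 1)%R.

Local Notation N g := (wnorm X w (EFin \o g)).
Local Notation B t := (rball_norm mu v rho p t).
Local Notation chi t := (\1_[set z | (t < rho z)%R] : T -> R).

Let mchi t : measurable_fun setT (chi t).
Proof. by apply: measurable_indic; exact: measurable_rho_gt. Qed.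

Let Bfin t : B t < +oo. Proof. exact: (rball_norm_lty rad hv hw p1 C0 hC). Qed.

Lemma rhardy_A_lower_pgt1 : (1 < p)%R ->
  rhardy_A rho X p v w a <= (C / lower_factor a p)%:E.
Proof.
move=> pgt1; have /andP[a0 a1] := a01.
pose q := conj_exp p; have q0 : (0 < q)%R := conj_exp_gt0 pgt1.
have p0 : (0 < p)%R by exact: lt_trans pgt1.
have q1 : (1 < q)%R by rewrite /q /conj_exp ltr_pdivlMr ?subr_gt0//; lra.
pose S := dual_density v p.
have mS : measurable_fun setT S := measurable_dual_density hv p.
have S0 y : (0 <= S y)%R by exact: dual_density_ge0.
have Sfin := dual_density_fin hv pgt1 Bfin : forall r, \int[mu]_(y in rball rho r) (S y)%:E < +oo.
pose V := rmass mu rho S.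
have BV t : fine (B t) = (V t `^ q^-1)%R by exact: fine_rball_norm.
have V0 t : (0 < t)%R -> (0 < V t)%R by exact: (rmass_dual_gt0 rad hv).
have Vge0 t : (0 <= V t)%R by apply: fine_ge0; exact: (rball_integral_ge0 _ _ S0).
have mV c : measurable_fun setT (fun y => V (rho y) `^ c)%R.
  by apply: (measurableT_comp (measurable_powR _)); exact: measurable_rmass.
pose b := ((1 - a) / q)%R; have b0 : (0 < b)%R by rewrite divr_gt0// subr_gt0.
have b1 : (b <= 1)%R by rewrite ler_pdivrMr// mul1r; lra.
pose Q := (b^-1 `^ p + (a * (p - 1))^-1)%R.
have ap0 : (0 < a * (p - 1))%R by rewrite mulr_gt0// subr_gt0.
have Q0 : (0 < Q)%R by rewrite addr_gt0 ?powR_gt0 ?invr_gt0.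
have lfE : (C / lower_factor a p = C * (b * Q `^ p^-1))%R.
  rewrite /lower_factor /at_exponent gt_eqF// -/q.
  have -> : (q / (1 - a) = b^-1)%R by rewrite invf_div.
  rewrite -/Q; congr (_ * _)%R; rewrite /b; field.
  by rewrite !gt_eqF ?powR_gt0// subr_gt0.
rewrite lfE; apply: ge_ereal_sup => _ [t t0 <-].
rewrite (rhardy_A_term _ _ _ _ Bfin).
have -> : (fine (B t) `^ a = V t `^ (a / q))%R by rewrite BV -powRrM mulrC.
have -> : (fun x => chi t x * fine (B (rho x)) `^ (1 - a))%R =
    (fun x => chi t x * V (rho x) `^ b)%R.
  by apply/funext => x; rewrite BV -powRrM (mulrC q^-1%R).
have mh0 : measurable_fun setT (fun x => chi t x * V (rho x) `^ b)%R.
  exact: (measurable_funM (mchi t) (mV b)).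
(* The inner constant gives the ball the mass [V(t)^b / b], which makes up for the lower endpoint of
   the integral over the shell. *)
pose k y := (if (rho y < t)%R then V t `^ (b - 1) / b else V (rho y) `^ (b - 1))%R.
have k0 y : (0 <= k y)%R.
  rewrite /k; case: ifP => _; last exact: powR_ge0.
  by apply: divr_ge0; [exact: powR_ge0|exact: ltW].
pose f y := (k y * S y)%R.
have mk : measurable_fun setT k.
  apply: measurable_fun_ifT => //.
  by apply: measurable_fun_ltr.
have mf : measurable_fun setT f by exact: (measurable_funM mk mS).
have f0 y : (0 <= f y)%R by rewrite mulr_ge0.
have f_ball : \int[mu]_(y in rball rho t) (f y)%:E = (V t `^ b / b)%:E.
  transitivity (\int[mu]_(y in rball rho t) ((V t `^ (b - 1) / b)%:E * (S y)%:E)).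
    by apply: eq_integral => y /set_mem yt; rewrite /f /k yt EFinM.
  rewrite ge0_integralZl//; last 4 first.
  - exact: measurable_rball.
  - by apply/measurable_EFinP; exact: measurable_funTS.
  - by move=> y _; rewrite lee_fin.
  - by rewrite lee_fin divr_ge0 ?powR_ge0// ltW.
  rewrite (rmassE S0 Sfin) -/V -EFinM; congr EFin.
  by rewrite powRB1 ?V0//; field; rewrite !gt_eqF// V0.
have f_shell r : (t <= r)%R ->
    \int[mu]_(y in rshell rho t r) (f y)%:E = ((V r `^ b - V t `^ b) / b)%:E.
  move=> tr; rewrite -(rshell_integral_powR mrho (radial_sphere rad) mS S0 Sfin)//.
  - by apply: eq_integral => y /set_mem /andP[ty _]; rewrite /f /k ltNge ty.
  - by rewrite b0.
  - exact: V0.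
have f_int r : (t <= r)%R -> \int[mu]_(y in rball rho r) (f y)%:E = (V r `^ b / b)%:E.
  move=> tr; rewrite (rball_integral_split mu mrho mf f0 tr) f_ball (f_shell _ tr).
  by rewrite -EFinD; congr EFin; rewrite mulrBl addrC subrK.
have ffin r : \int[mu]_(y in rball rho r) (f y)%:E < +oo.
  have tr : (t <= Num.max r t)%R by rewrite le_max lexx orbT.
  apply: le_lt_trans (ltry (V (Num.max r t) `^ b / b)); rewrite -f_int//.
  by apply: le_rball_integral => //; rewrite le_max lexx.
have fp y : ((f y * fine (v y)) `^ p = k y `^ p * S y)%R.
  rewrite /f -mulrA powRM; [|exact: k0|].
    by rewrite (dual_density_weight hv).
  by apply: mulr_ge0; [exact: S0|rewrite -invr_ge0; exact: (winv_ge0 hv)].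
have mfp : measurable_fun setT (fun y => k y `^ p * S y)%R.
  exact: (measurable_funM (measurableT_comp (measurable_powR _) mk) mS).
have fp0 y : (0 <= k y `^ p * S y)%R by rewrite mulr_ge0// powR_ge0.
pose e := (a * (p - 1))%R.
(* Positivity of [e = a (p - 1)] makes the integral over the exterior converge; the factor [1 / e]
   is the second term of [Q]. *)
have eE : ((b - 1) * p = - e - 1)%R.
  by rewrite /b /e /q /conj_exp; field; rewrite !gt_eqF ?subr_gt0//.
have fnorm : \int[mu]_y ((f y * fine (v y)) `^ p)%:E <= (V t `^ (- e) * Q)%:E.
  rewrite (eq_integral (fun y => (k y `^ p * S y)%:E)); last by move=> y _; rewrite fp.
  rewrite (_ : setT = rball rho t `|` [set y | (t <= rho y)%R]); last first.
    apply/esym; rewrite -subTset => y _ /=.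
    by have [yt|yt] := ltP (rho y) t; [left|right].
  rewrite (ge0_integral_setU mu (measurable_rball mrho t) (measurable_rho_ge mrho t)); last 3 first.
  - by apply/measurable_EFinP; exact: measurable_funTS.
  - by move=> y _; rewrite lee_fin.
  - apply/disj_setPS => y [yt /= ty]; by move: yt; rewrite /rball /= ltNge ty.
  rewrite mulrDr EFinD; apply: leeD.
    rewrite (eq_integral (fun y => ((V t `^ (b - 1) / b) `^ p)%:E * (S y)%:E)); last first.
      by move=> y /set_mem yt; rewrite /k yt EFinM.
    rewrite ge0_integralZl//; last 4 first.
    - exact: measurable_rball.
    - by apply/measurable_EFinP; exact: measurable_funTS.
    - by move=> y _; rewrite lee_fin.
    - by rewrite lee_fin powR_ge0.
    rewrite (rmassE S0 Sfin) -/V -EFinM lee_fin powRM ?powR_ge0 ?invr_ge0 ?(ltW b0)//.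
    rewrite -powRrM eE powRB1 ?V0// le_eqVlt; apply/orP; left; apply/eqP.
    by field; rewrite gt_eqF// V0.
  rewrite (eq_integral (fun y => (V (rho y) `^ (- e - 1) * S y)%:E)); last first.
    by move=> y /set_mem /= ty; rewrite /k ltNge ty/= -powRrM eE.
  have := rho_ge_integral_powRN mrho (radial_sphere rad) mS S0 Sfin (b := e) (a := t) ap0.
  by apply; exact: V0.
have mh : measurable_fun setT (fun x => b^-1 * (chi t x * V (rho x) `^ b))%R.
  exact: (measurable_funM (measurable_cst _) mh0).
have hh x : (0 <= b^-1 * (chi t x * V (rho x) `^ b) <= rmass mu rho f (rho x))%R.
  rewrite !mulr_ge0 ?powR_ge0 ?invr_ge0 ?(ltW b0) ?indicE//=.
  case: (boolP (x \in _)) => [|_]; last first.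
    by rewrite mul0r mulr0; apply: fine_ge0; exact: (rball_integral_ge0 _ _ f0).
  rewrite inE /= => tx; rewrite mul1r /rmass f_int/= ?(ltW tx)//.
  by rewrite mulrC.
have := rhardy_test rad hv hw p1 hC mf f0 ffin mh hh.
have bV0 : (0 <= b^-1)%R by rewrite invr_ge0 ltW.
rewrite (@wnormZ _ _ _ _ X w hw _ _ bV0 mh0) => h.
have {h} : b^-1%:E * N (fun x => chi t x * V (rho x) `^ b)%R <=
    C%:E * ((V t `^ (- e) * Q)%:E `^ p^-1).
  apply: le_trans h _; rewrite lee_wpmul2l ?lee_fin ?(ltW C0)//.
  apply: le_poweR => //; first by rewrite invr_ge0 ltW.
  by apply: integral_ge0 => y _; rewrite lee_fin powR_ge0.
rewrite poweR_EFin lee_pdivrMl// => h.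
apply: le_trans (lee_wpmul2l _ h) _; first by rewrite lee_fin powR_ge0.
rewrite -!EFinM lee_fin powRM ?powR_ge0 ?(ltW Q0)// -powRrM.
have -> : (- e / p = - (a / q))%R.
  by rewrite /e /q /conj_exp; field; rewrite !gt_eqF ?subr_gt0//.
rewrite powRN [leLHS](_ : _ = C * (b * Q `^ p^-1))%R//.
by field; rewrite gt_eqF// powR_gt0// V0.
Qed.

Let nB s := fine (B s).

Let nB_nd : {homo nB : s t / (s <= t)%R}.
Proof.
move=> s t st; rewrite fine_le ?ge0_fin_numE ?rball_norm_ge0//.
exact: (le_rball_norm hv mrho p1 (radial_setT_gt0 rad) st).
Qed.

Let mnB : measurable_fun setT (fun x => nB (rho x)).
Proof. exact: (measurableT_comp (nondecreasing_measurable measurableT nB_nd)). Qed.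

Section p_eq1.
Hypothesis pE : p = 1%R.

Let Nchi_le t l : (0 < l)%R -> (l < nB t)%R -> N (chi t) <= (C / l)%:E.
Proof.
move=> l0 lt; have lB : l%:E < B t.
  by rewrite -[B t]fineK ?lte_fin// ge0_fin_numE ?rball_norm_ge0.
have := rball_norm1_chi rad hv hw p1 C0 hC pE l0 lB.
by rewrite mulrC EFinM lee_pdivlMl.
Qed.

Let Nchi_le_sup t : (0 < nB t)%R -> N (chi t) <= (C / nB t)%:E.
Proof.
move=> n0; apply/lee_addgt0Pr => e e0.
(* Solves [C / l = C / nB t + e]. *)
pose l := (C / (C / nB t + e))%R.
have Cn0 : (0 < C / nB t)%R by rewrite divr_gt0.
have l0 : (0 < l)%R by rewrite divr_gt0// addr_gt0.
have ln : (l < nB t)%R.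
  rewrite /l ltr_pdivrMr ?addr_gt0// mulrDr mulrCA mulfV ?gt_eqF// mulr1.
  by rewrite ltrDl mulr_gt0.
have := Nchi_le l0 ln; rewrite /l invfM invrK mulrA mulfV ?gt_eqF// mul1r.
by rewrite EFinD.
Qed.

Let above l := [set x | (l < nB (rho x))%R].

Let mabove l : measurable (above l).
Proof.
rewrite (_ : above l = (fun x => nB (rho x)) @^-1` `]l, +oo[%classic).
  by rewrite -[X in measurable X]setTI; exact: mnB.
by apply/seteqP; split => y /=; rewrite in_itv/= ?andbT.
Qed.

(* Up to a null set, [above l] is the exterior of a ball, and the balls of
   larger radius have [nB] above [l]. *)
Let Nabove_le l : (0 < l)%R -> N (\1_(above l) : T -> R) <= (C / l)%:E.
Proof.
move=> l0; pose Z : set R := [set r | (l < nB r)%R].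
have mI : measurable_fun setT (\1_(above l) : T -> R) by exact: measurable_indic.
have [Z0|/set0P Z0] := eqVneq Z set0.
  have -> : (\1_(above l) : T -> R) = (fun x => 0 * chi 0%R x)%R.
    apply/funext => x; rewrite mul0r indicE memNset// => lx.
    by have : Z (rho x) by []; rewrite Z0.
  rewrite (@wnormZ _ _ _ _ X w hw _ _ (lexx (0%R : R)) (mchi 0%R)) mul0e lee_fin.
  by rewrite divr_ge0 ?ltW.
have nB0 r : (r <= 0)%R -> nB r = 0%R.
  move=> r0; rewrite /nB /rball_norm (_ : rball rho r = set0 :> set T).
    rewrite patch_set0 Lnorm0//.
    by rewrite pE hoelder_conjugate1.
  by rewrite -subset0 => y; rewrite /rball /= ltNge (le_trans r0).
have Zlb : lbound Z (0%R : R).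
  by move=> r lr; rewrite leNgt; apply/negP => /ltW/nB0 nr; move: lr; rewrite /Z/= nr ltNge (ltW l0).
pose rs := inf Z.
have Zinf : has_inf Z by split => //; exists (0%R : R).
apply: (@le_trans _ _ (N (chi rs))).
  apply: (le_wnorm_ae X hw mI (mchi rs)).
  have [A [mA A0 sA]] : {ae mu, forall y, rho y != rs}.
    exists [set y | rho y = rs]; split => //.
    - rewrite (_ : mkset _ = rho @^-1` [set rs]) //.
      by rewrite -[X in measurable X]setTI; exact: mrho.
    - exact: (radial_sphere rad).
    - by move=> y /= /negP; rewrite negbK => /eqP.
  exists A; split => //; apply: subset_trans sA => x /= H; contra: H => xr.
  rewrite indicE ler0n/= !indicE ler_nat.
  have [/set_mem lx|//] := boolP (x \in above l).
  rewrite mem_set//=; rewrite lt_neqAle eq_sym xr/=; apply: ge_inf => //.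
  by exists (0%R : R).
(* The infimum [rs] need not belong to [Z]; radii beyond it do, and their exteriors increase to that
   of [rs]. *)
apply: (@le_wnorm_cvg _ _ _ _ X w hw (fun k => chi (rs + k.+1%:R^-1))) => //.
  apply: nearW => x; split => [k|i j ij|].
  - by rewrite indicE.
  - rewrite !indicE ler_nat; have [/set_mem /= h|//] := boolP (x \in _).
    rewrite mem_set//=; apply: le_lt_trans h; rewrite lerD2l lef_pV2 ?posrE// ler_nat.
    exact: ij.
  have [rx|rx] := ltP rs (rho x); last first.
    rewrite (_ : (fun k => _) = cst 0%R).
      rewrite indicE memNset/=; first exact: cvg_cst.
      by rewrite ltNge rx.
    apply/funext => k /=; rewrite indicE memNset//= => h.
    have : (rs < rho x)%R by apply: lt_trans h; rewrite ltrDl.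
    by rewrite ltNge rx.
  have [k hk] := ltr_add_invr rx.
  apply: cvg_near_cst; exists k => // j /= kj.
  rewrite !indicE !mem_set//=; apply: le_lt_trans hk.
  by rewrite lerD2l lef_pV2 ?posrE// ler_nat.
move=> k; apply: Nchi_le => //.
have e0 : (0 < k.+1%:R^-1 :> R)%R by rewrite invr_gt0.
have [z Zz zr] := inf_adherent e0 Zinf.
by apply: lt_le_trans Zz _; apply: nB_nd; exact: ltW.
Qed.

(** Truncation makes the norm finite, so that its growth in the level [l] can be integrated among
    real numbers before [l] tends to infinity. *)
Let trunc t l x := (chi t x * Num.min (nB (rho x)) l `^ (1 - a))%R.

Let nB_ge0 s : (0 <= nB s)%R.
Proof. by apply: fine_ge0; exact: rball_norm_ge0. Qed.

Let mtrunc t l : measurable_fun setT (trunc t l).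
Proof.
apply: (measurable_funM (mchi t)); apply: (measurableT_comp (measurable_powR _)).
exact: (measurable_minr mnB (measurable_cst _)).
Qed.

(** Formally, the norm [psi] of the truncation grows in [l] at a rate of at most
    [b l^(b-1) C / l = b C l^(-a-1)]. Integration from [l0 = N(t)] contributes at most
    [C (b/a) l0^(-a)], and the initial value is at most [C l0^(-a)]. The sum is [(C / a) l0^(-a)],
    because [1 + b / a = 1 / a]. *)
Lemma rhardy_A_lower_p1 : rhardy_A rho X p v w a <= (C / a)%:E.
Proof.
have /andP[a0 a1] := a01.
apply: ge_ereal_sup => _ [t t0 <-].
rewrite (rhardy_A_term _ _ _ _ Bfin) -/(nB t).
pose l0 := nB t.
have l00 : (0 < l0)%R by rewrite fine_gt0// Bfin (rball_norm_gt0 rad hv p1).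
pose b := (1 - a)%R; have b0 : (0 < b)%R by rewrite subr_gt0.
have trunc0 l x : (0 <= trunc t l x)%R by rewrite mulr_ge0 ?powR_ge0// indicE.
have Ntrunc_le l : (0 <= l)%R -> N (trunc t l) <= (l `^ b * (C / l0))%:E.
  move=> lge0; apply: (@le_trans _ _ (N (fun x => l `^ b * chi t x)%R)).
    apply: (le_wnorm X hw (mtrunc t l) (measurable_funM (measurable_cst _) (mchi t))) => x.
    rewrite trunc0/= /trunc mulrC ler_wpM2r ?indicE//.
    by apply: ge0_ler_powR; rewrite ?nnegrE ?le_min ?nB_ge0 ?lge0 ?(ltW b0)// ge_min lexx orbT.
  rewrite (@wnormZ _ _ _ _ X w hw _ _ (powR_ge0 _ _) (mchi t)) EFinM.
  by rewrite lee_wpmul2l ?lee_fin ?powR_ge0// Nchi_le_sup.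
have Ntrunc0 l : 0 <= N (trunc t l) by exact: (wnorm_ge0 X hw (mtrunc t l)).
pose psi l := fine (N (trunc t l)).
have NE l : (0 <= l)%R -> N (trunc t l) = (psi l)%:E.
  move=> lge0; rewrite fineK// ge0_fin_numE//.
  by apply: le_lt_trans (Ntrunc_le l lge0) _; rewrite ltry.
(* Raising the truncation level from [l] to [l'] only matters on [above l]. *)
have incr l l' : (l0 <= l)%R -> (l <= l')%R ->
    (psi l' - psi l <= (l' `^ b - l `^ b) * (C / l))%R.
  move=> l0l ll'; have lpos : (0 < l)%R by exact: lt_le_trans l0l.
  have l'pos : (0 < l')%R by exact: lt_le_trans ll'.
  have dpos : (0 <= l' `^ b - l `^ b)%R.
    by rewrite subr_ge0 ge0_ler_powR ?nnegrE ?(ltW b0) ?(ltW lpos) ?(ltW l'pos).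
  have mI : measurable_fun setT (\1_(above l) : T -> R) by exact: measurable_indic.
  have mdI : measurable_fun setT (fun x => (l' `^ b - l `^ b) * \1_(above l) x)%R.
    exact: (measurable_funM (measurable_cst _) mI).
  rewrite lerBlDl -lee_fin EFinD -(NE l' (ltW l'pos)) -(NE l (ltW lpos)).
  apply: (@le_trans _ _ (N (fun x => trunc t l x + (l' `^ b - l `^ b) * \1_(above l) x)%R)).
    apply: (le_wnorm X hw (mtrunc t l') (measurable_funD (mtrunc t l) mdI)) => x.
    rewrite trunc0/= /trunc.
    rewrite [chi t x]indicE; case: (x \in _); last first.
      by rewrite !mul0r add0r mulr_ge0// indicE.
    rewrite !mul1r indicE; have [/set_mem /= lx|] := boolP (x \in above l).
      rewrite mulr1 (min_idPr (ltW lx)) subrKC.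
      apply: ge0_ler_powR; rewrite ?nnegrE ?le_min ?nB_ge0 ?(ltW l'pos) ?(ltW b0)//.
      by rewrite ge_min lexx orbT.
    rewrite mulr0 addr0 notin_setE /above /= => /negP; rewrite -leNgt => nl.
    by rewrite (min_idPl nl) (min_idPl (le_trans nl ll')).
  apply: le_trans (le_wnormD X hw (mtrunc t l) mdI) _.
  rewrite leeD2l// (@wnormZ _ _ _ _ X w hw _ _ dpos mI) EFinM.
  by rewrite lee_wpmul2l ?lee_fin// Nabove_le.
(* A primitive of [b C l^(-a-1)]. In [k], the factor [b l0^(b-1)] is the slope of [l^b] at [l0], its
   largest value on the range since [b < 1]. *)
pose F l := (- (C * (b / a) * l `^ (- a)))%R.
pose k l := (b * l0 `^ (b - 1) * (C / l))%R.
(* [F] dominates [psi] because [(l'^b - l^b) C / l'] is at most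
   [F l' - F l]; replacing [l'] by [l] in the denominator is a small increment. *)
have main l : (l0 <= l)%R -> (psi l - F l <= psi l0 - F l0)%R.
  move=> l0l; apply: (@le_of_small_increments R (fun l => psi l - F l) id k l0 l)%R => //.
  - move=> s s' l0s ss' _; rewrite /k ler_wpM2l ?mulr_ge0 ?powR_ge0 ?(ltW b0)//.
    have s0 : (0 < s)%R by exact: lt_le_trans l0s.
    by rewrite ler_wpM2l ?(ltW C0)// lef_pV2 ?posrE//; exact: lt_le_trans ss'.
  - by move=> u ul; exists u.
  move=> s s' l0s ss' _.
  have s0 : (0 < s)%R by exact: lt_le_trans l0s.
  have s'0 : (0 < s')%R by exact: lt_le_trans ss'.
  have h1 := incr s s' l0s ss'.
  have b01 : (0 <= b <= 1)%R by rewrite (ltW b0)/= /b; lra.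
  have h2 : (s' `^ b - s `^ b <= b * l0 `^ (b - 1) * (s' - s))%R.
    have := powR_tangent_ge s0 s'0 b01.
    have : (b * s `^ (b - 1) * (s' - s) <= b * l0 `^ (b - 1) * (s' - s))%R.
      rewrite ler_wpM2r ?subr_ge0// ler_wpM2l ?(ltW b0)//.
      by apply: powR_nincr => //; rewrite /b; lra.
    by lra.
  (* The right-hand side is the integral of [b x^(b-2)] over [[s, s']], and the left-hand side
     replaces one factor [1 / x] by its least value [1 / s']. Algebraically it is Bernoulli's
     inequality for [(s / s')^a]. *)
  have h3 : ((s' `^ b - s `^ b) / s' <= (b / a) * (s `^ (- a) - s' `^ (- a)))%R.
    have bern := @powR_bernoulli_le R (s / s') a (divr_gt0 s0 s'0) ltac:(lra).
    have ba : (b - 1 = - a)%R by rewrite /b; lra.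
    have Es : (s `^ (- a) = s `^ b / s)%R by rewrite -ba powRB1.
    have Es' : (s' `^ (- a) = s' `^ b / s')%R by rewrite -ba powRB1.
    have EX : (s' `^ (- a) = s `^ (- a) * (s / s') `^ a)%R.
      rewrite !powRN (powR_div a s'0 s0) invfM divfK//.
      by rewrite gt_eqF// powR_gt0// divr_gt0.
    have h : (s' `^ (- a) <= s `^ (- a) * (1 + a * (s / s' - 1)))%R.
      by rewrite EX ler_wpM2l ?powR_ge0.
    have e3 : (s `^ (- a) * (1 + a * (s / s' - 1)) =
        b * s `^ (- a) + a * (s `^ b / s'))%R.
      by rewrite Es /b; field; rewrite !gt_eqF.
    rewrite e3 in h.
    rewrite mulrAC ler_pdivlMr// mulrBl -Es'; move: h; rewrite /b; lra.
  have Ci : (0 <= C / s - C / s')%R.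
    by rewrite subr_ge0 ler_wpM2l ?(ltW C0)// lef_pV2.
  have h4 := ler_wpM2l Ci h2; have h5 := ler_wpM2l (ltW C0) h3.
  rewrite /F /k /=; lra.
have bound l : (l0 <= l)%R -> (psi l <= C / a * l0 `^ (- a))%R.
  move=> l0l; have lge0 : (0 <= l)%R by apply: le_trans l0l; exact: ltW.
  have := main l l0l.
  have : (F l <= 0)%R by rewrite oppr_le0 !mulr_ge0 ?powR_ge0 ?invr_ge0// ltW.
  have : (psi l0 <= l0 `^ b * (C / l0))%R.
    by rewrite -lee_fin -NE ?(ltW l00)// Ntrunc_le// ltW.
  have -> : (l0 `^ b * (C / l0) = C * l0 `^ (- a))%R.
    by rewrite (_ : - a = b - 1)%R ?powRB1//; [ring|rewrite /b; lra].
  have -> : (C / a * l0 `^ (- a) = C * l0 `^ (- a) + C * (b / a) * l0 `^ (- a))%R.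
    by rewrite /b; field; rewrite gt_eqF.
  rewrite /F; lra.
have : N (fun x => chi t x * nB (rho x) `^ (1 - a))%R <= (C / a * l0 `^ (- a))%:E.
  have mlim : measurable_fun setT (fun x => chi t x * nB (rho x) `^ (1 - a))%R.
    exact: (measurable_funM (mchi t) (measurableT_comp (measurable_powR _) mnB)).
  have lk i : (l0 <= l0 + i%:R)%R by rewrite lerDl.
  have lk0 i : (0 <= l0 + i%:R)%R by apply: le_trans (lk i); exact: ltW.
  apply: (@le_wnorm_cvg _ _ _ _ X w hw (fun i => trunc t (l0 + i%:R)))%R => //.
    apply: nearW => x; split => [i|i j ij|].
    - exact: trunc0.
    - rewrite /trunc ler_wpM2l ?indicE//.
      have mij : (Num.min (nB (rho x)) (l0 + i%:R) <= Num.min (nB (rho x)) (l0 + j%:R))%R.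
        by rewrite le_min !ge_min lexx lerD2l ler_nat ij orbT.
      apply: ge0_ler_powR => //; first exact: ltW.
        by rewrite nnegrE le_min nB_ge0 lk0.
      by rewrite nnegrE le_min nB_ge0 lk0.
    apply: cvg_near_cst; exists (Num.bound (nB (rho x))) => // j /= kj.
    rewrite /trunc (min_idPl _)//.
    apply: (le_trans (ltW (archi_boundP (nB_ge0 (rho x))))).
    by apply: (@le_trans _ _ j%:R%R); [rewrite ler_nat|rewrite lerDr ltW].
  by move=> i; rewrite NE// lee_fin; exact: bound.
rewrite powRN EFinM [X in _ <= X]muleC lee_pdivlMl ?powR_gt0//.
Qed.

End p_eq1.

End lower_bound.

(** * The Euclidean norm on R^n *)

Section euclidean_radial.
Context (R : realType).

Let sumsq n (x : n.-tuple R) : R := (\sum_(i < n) tnth x i ^+ 2)%R.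

Let measurable_sumsq n : measurable_fun setT (@sumsq n).
Proof.
apply: measurable_sum => i; apply: measurable_funX; exact: measurable_tnth.
Qed.

Let sumsq_ge0 n (x : n.-tuple R) : (0 <= sumsq x)%R.
Proof. by apply: sumr_ge0 => i _; exact: sqr_ge0. Qed.

Lemma measurable_Rn n (A : set (n.-tuple R)) : measurable A ->
  (measurable : set (set (Rn R n))) A.
Proof. exact: caratheodory_measurable_mu_ext. Qed.

Lemma leb_borel n (A : set (n.-tuple R)) : measurable A ->
  leb R n A = borel_lebesgue R n A.
Proof. exact: measurable_mu_extE. Qed.

(** The root is written as the power [1/2] to obtain Borel measurability, which passes to [Rn] since
    Borel sets are Caratheodory measurable. *)
Lemma measurable_eucl n : measurable_fun setT (@eucl R n).
Proof.
have mb : measurable_fun setT ((fun s : R => s `^ 2^-1)%R \o @sumsq n).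
  apply: measurableT_comp; first exact: measurable_powR.
  exact: measurable_sumsq.
move=> _ Y mY; have := mb measurableT Y mY.
move/(@measurable_Rn n); rewrite (_ : _ \o _ = @eucl R n)//.
by apply/funext => x; rewrite /eucl /= powR12_sqrt// sumsq_ge0.
Qed.

Let sphere_measurable n (c : R) : measurable [set x : n.-tuple R | sumsq x = c].
Proof.
rewrite (_ : mkset _ = @sumsq n @^-1` [set c]) //.
by rewrite -[X in measurable X]setTI; exact: measurable_sumsq.
Qed.

(* All one-dimensional sections of a sphere have at most two points. *)
Let borel_sphere0 n (c : R) :
  borel_lebesgue R n.+1 [set x | sumsq x = c] = 0.
Proof.
rewrite /= /prod_lebesgue /pushforward /= /product_measure1.
apply: integral0_eq => x _ /=.
pose e := Num.sqrt (c - sumsq x).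
set A := xsection _ x.
have mA : measurable (A : set (measurableTypeR R)).
  apply: measurable_xsection; rewrite -[X in measurable X]setTI.
  by apply: measurable_tcons => //; exact: sphere_measurable.
have : A `<=` [set e] `|` [set - e]%R.
  move=> s; rewrite /A /xsection /= inE /= /sumsq big_ord_recl/= => sc.
  have sE : (s ^+ 2 = c - sumsq x)%R.
    rewrite -sc tnth0 /sumsq; under [X in (_ + X - _)%R]eq_bigr do rewrite tnthS.
    by rewrite addrK.
  have : (s ^+ 2 == e ^+ 2)%R by rewrite sE sqr_sqrtr// -sE sqr_ge0.
  by rewrite eqf_sqr => /orP[/eqP ->|/eqP ->]; [left|right].
move=> sA; apply/eqP; rewrite eq_le measure_ge0 andbT.
have m1 z : measurable ([set z] : set (measurableTypeR R)) by exact: measurable_set1.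
apply: (@le_trans _ _ (lebesgue_measure ([set e] `|` [set - e]%R))).
  by apply: le_measure; rewrite ?inE//; exact: measurableU.
apply: le_trans (measureU2 _ (m1 _) (m1 _)) _.
by rewrite [X in X + _]lebesgue_measure_set1 [X in _ + X]lebesgue_measure_set1 adde0.
Qed.

(** For [n = 0] the sphere of radius 0 is the single point of the space, of mass 1. Otherwise the
    sphere lies in a Borel null set given by the sum of squares. *)
Lemma leb_sphere0 n (r : R) : (0 < n)%N -> leb R n [set y | eucl y = r] = 0.
Proof.
case: n => // n _.
have mS : (measurable : set (set (Rn R n.+1))) [set x | sumsq x = (r ^+ 2)%R].
  exact: (measurable_Rn (sphere_measurable (r ^+ 2)%R)).
have S0 : leb R n.+1 [set x | sumsq x = (r ^+ 2)%R] = 0.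
  rewrite leb_borel; last exact: sphere_measurable.
  exact: borel_sphere0.
apply: (@subset_measure0 _ _ _ _ _ [set x : Rn R n.+1 | sumsq x = (r ^+ 2)%R]).
- rewrite (_ : mkset _ = @eucl R n.+1 @^-1` [set r]) //.
  by rewrite -[X in measurable X]setTI; exact: measurable_eucl.
- exact: mS.
- by move=> x /= <-; rewrite sqr_sqrtr// sumsq_ge0.
- exact: S0.
Qed.

Let box n (A : set R) : set (n.-tuple R) := [set x | forall i, A (tnth x i)].

Let leb_box n (A : set R) (l : R) : measurable A -> lebesgue_measure A = l%:E ->
  measurable (@box n A) /\ leb R n (@box n A) = (l ^+ n)%:E.
Proof.
move=> mA Al; have [mB BE] := @borel_lebesgue_box R n (fun=> A) (fun=> mA).
split => //; rewrite leb_borel// BE.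
under eq_bigr do rewrite Al.
elim: n {mB BE} => [|n IH]; first by rewrite big_ord0 expr0.
by rewrite big_ord_recl IH exprS EFinM.
Qed.

Let leb_mono n (A B : set (n.-tuple R)) :
  (measurable : set (set (Rn R n))) A -> (measurable : set (set (Rn R n))) B ->
  A `<=` B -> leb R n A <= leb R n B.
Proof. by move=> mA mB AB; apply: le_measure; rewrite ?inE. Qed.

Lemma radial_eucl n : (0 < n)%N -> radial (leb R n) (@eucl R n).
Proof.
move=> n0; have n0R : (0 < n%:R :> R)%R by rewrite ltr0n.
have mball r : measurable (rball (@eucl R n) r) by exact: (measurable_rball (@measurable_eucl n)).
have coord (x : n.-tuple R) i : (`|tnth x i| <= eucl (x : Rn R n))%R.
  rewrite -(@ler_pXn2r _ 2) ?nnegrE ?sqrtr_ge0// sqr_sqrtr ?sumsq_ge0// real_normK ?num_real//.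
  by rewrite (bigD1 i)//= lerDl sumr_ge0// => j _; exact: sqr_ge0.
split.
- exact: measurable_eucl.
- by move=> y; exact: sqrtr_ge0.
- by move=> r; exact: leb_sphere0.
- move=> r; pose c := Num.max r 0%R; have c0 : (0 <= c)%R by rewrite le_max lexx orbT.
  have lI : lebesgue_measure (`[(- c)%R, c]%classic : set R) = (c - - c)%:E.
    by rewrite lebesgue_measure_itv/= lte_fin; case: ifPn => //; rewrite -leNgt => h; congr EFin; lra.
  have [mB BE] := @leb_box n _ _ (measurable_itv `[(- c)%R, c]) lI.
  apply: (@le_lt_trans _ _ (leb R n (@box n `[(- c)%R, c]%classic))).
    apply: leb_mono => //; first exact: measurable_Rn.
    move=> x xr i; rewrite /= in_itv/= -ler_norml; apply: (le_trans (coord x i)).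
    by apply: (le_trans (ltW xr)); rewrite le_max lexx.
  by rewrite BE ltry.
(* A cube inside the ball: its points have norm at most [sqrt n c <= n c = r / 2]. *)
- move=> r r0; pose c := (r / 2 / n%:R)%R; have c0 : (0 < c)%R by rewrite !divr_gt0.
  have lI : lebesgue_measure (`[(- c)%R, c]%classic : set R) = (c - - c)%:E.
    by rewrite lebesgue_measure_itv/= lte_fin ifT//; lra.
  have [mB BE] := @leb_box n _ _ (measurable_itv `[(- c)%R, c]) lI.
  apply: (@lt_le_trans _ _ (leb R n (@box n `[(- c)%R, c]%classic))).
    by rewrite BE lte_fin exprn_gt0//; lra.
  apply: leb_mono => //; first exact: measurable_Rn.
  move=> x xc; rewrite /rball /=.
  apply: (@le_lt_trans _ _ (r / 2)%R); last by lra.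
  rewrite -(@ler_pXn2r _ 2) ?nnegrE ?sqrtr_ge0//; last by lra.
  rewrite sqr_sqrtr ?sumsq_ge0//.
  apply: (@le_trans _ _ (\sum_(i < n) c ^+ 2)%R).
    apply: ler_sum => i _; rewrite -real_normK ?num_real// ler_pXn2r ?nnegrE ?(ltW c0)//.
    by have := xc i; rewrite /= in_itv/= -ler_norml.
  rewrite sumr_const card_ord -[(c ^+ 2 *+ n)%R]mulr_natl.
  have -> : (r / 2 = n%:R * c)%R by rewrite /c [RHS]mulrC divfK// gt_eqF.
  rewrite [leRHS]exprMn ler_wpM2r ?sqr_ge0// -natrX ler_nat.
  by rewrite expnS expn1 leq_pmulr.
(* A unit cube outside of the ball: each coordinate exceeds [c >= r], and [n > 0] provides one. *)
- move=> r; pose c := Num.max r 0%R.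
  have lI : lebesgue_measure (`]c, (c + 1)%R]%classic : set R) = 1%:E.
    by rewrite lebesgue_measure_itv/= lte_fin ifT ?ltrDl// -EFinD; congr EFin; lra.
  have [mB BE] := @leb_box n _ _ (measurable_itv `]c, (c + 1)%R]) lI.
  apply: (@lt_le_trans _ _ (leb R n (@box n `]c, (c + 1)%R]%classic))).
    by rewrite BE expr1n.
  apply: leb_mono.
  + exact: measurable_Rn.
  + exact: (measurable_rho_gt (@measurable_eucl n)).
  move=> x xc /=; have := xc (Ordinal n0); rewrite /= in_itv/= => /andP[cx _].
  apply: (lt_le_trans _ (le_trans (ler_norm _) (coord x (Ordinal n0)))).
  by apply: le_lt_trans cx; rewrite le_max lexx.
Qed.

End euclidean_radial.

(** * The criterion and the estimates of the best constant *)

Section radial_hardy_theorem.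
Context d (T : measurableType d) (R : realType).
Variables (mu : {measure set T -> \bar R}) (rho : T -> R).
Hypothesis rad : radial mu rho.
Variables (v w : T -> \bar R).
Hypotheses (hv : weight mu v) (hw : weight mu w).
Variables (X : BFS mu) (p M : R).
Hypotheses (p1 : (1 <= p)%R) (M0 : (0 < M)%R) (hconv : p_convex X w p M).

Lemma rhardy_A_le (C a : R) : (0 < C)%R -> rhardy_ineq rho X p v w C ->
  (0 < a < 1)%R -> rhardy_A rho X p v w a <= (C / lower_factor a p)%:E.
Proof.
move=> C0 hC a01; move: (p1); rewrite le_eqVlt => /predU1P[pE|pgt1].
  rewrite -[in lower_factor _ _]pE lower_factor1//.
  exact: (rhardy_A_lower_p1 rad hv hw p1 C0 hC a01 (esym pE)).
exact: (rhardy_A_lower_pgt1 rad hv hw p1 C0 hC a01 pgt1).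
Qed.

(** Norms are known to be nonnegative on measurable real functions; finiteness of [A] makes [N]
    real, so that the term at radius 1 is of this kind. *)
Lemma rhardy_A_ge0 (a : R) : (0 < a < 1)%R -> rhardy_A rho X p v w a < +oo ->
  0 <= rhardy_A rho X p v w a.
Proof.
move=> a01 Afin; have Bfin := rball_norm_fin rad hv hw p1 a01 Afin.
apply: le_trans (ereal_sup_ubound (ex_intro2 _ _ 1%R ltr01 erefl)).
rewrite (rhardy_A_term _ _ _ _ Bfin) mule_ge0 ?lee_fin ?powR_ge0//.
apply: (wnorm_ge0 X hw); apply: measurable_funM.
  by apply: measurable_indic; exact: (measurable_rho_gt (radial_measurable rad)).
have nd : {homo (fun t => fine (rball_norm mu v rho p t)) : s t / (s <= t)%R}.
  move=> s t st; rewrite fine_le ?ge0_fin_numE ?rball_norm_ge0//.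
  exact: (le_rball_norm hv (radial_measurable rad) p1 (radial_setT_gt0 rad) st).
apply: (measurableT_comp (measurable_powR _)).
exact: (measurableT_comp (nondecreasing_measurable measurableT nd) (radial_measurable rad)).
Qed.

Lemma rhardy_iff (a : R) : (0 < a < 1)%R ->
  (exists2 C : R, (0 < C)%R & rhardy_ineq rho X p v w C) <->
  rhardy_A rho X p v w a < +oo.
Proof.
move=> a01; split.
  by move=> [C C0 hC]; apply: le_lt_trans (rhardy_A_le C0 hC a01) _; rewrite ltry.
move=> Afin; pose A := (Num.max (fine (rhardy_A rho X p v w a)) 1)%R.
have A0 : (0 < A)%R by rewrite lt_max ltr01 orbT.
exists (M * upper_factor a p * A)%R; first by rewrite !mulr_gt0// upper_factor_gt0.
apply: (rhardy_ineq_upper rad) => //; rewrite /A.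
case: (rhardy_A _ _ _ _ _ _) Afin => [r _|//|_]; last by rewrite leNye.
by rewrite lee_fin le_max lexx.
Qed.

Lemma rhardy_best (C : R) : (0 < C)%R -> rhardy_ineq rho X p v w C ->
  (forall C' : R, (0 < C')%R -> rhardy_ineq rho X p v w C' -> (C <= C')%R) ->
  ereal_sup [set (lower_factor a p)%:E * rhardy_A rho X p v w a
              | a in [set a : R | (0 < a < 1)%R]] <= C%:E /\
  C%:E <= M%:E *
    ereal_inf [set (upper_factor a p)%:E * rhardy_A rho X p v w a
                | a in [set a : R | (0 < a < 1)%R]].
Proof.
move=> C0 hC best; split.
  apply: ge_ereal_sup => _ [a a01 <-]; have lf0 := lower_factor_gt0 a01 p1.
  apply: le_trans (lee_wpmul2l _ (rhardy_A_le C0 hC a01)) _; first by rewrite lee_fin ltW.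
  by rewrite -EFinM lee_fin mulrC divfK// gt_eqF.
rewrite -lee_pdivrMl//; apply: le_ereal_inf_tmp => _ [a a01 <-].
have uf0 := upper_factor_gt0 a01 p1.
have Afin := (rhardy_iff a01).1 (ex_intro2 _ _ C C0 hC).
(* The upper bound asks for a positive real majorant of [A(a)], which may be 0; it is applied to
   [A(a)] plus an excess that contributes exactly [e] to the constant. *)
rewrite lee_pdivrMl// muleA -EFinM; apply/lee_addgt0Pr => e e0.
have MU0 : (0 < M * upper_factor a p)%R by rewrite mulr_gt0.
have Age0 := rhardy_A_ge0 a01 Afin.
pose r := fine (rhardy_A rho X p v w a).
have AE : rhardy_A rho X p v w a = r%:E by rewrite fineK// ge0_fin_numE.
rewrite AE -EFinM -EFinD lee_fin.
have r0 : (0 <= r)%R by rewrite -lee_fin -AE.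
have -> : (M * upper_factor a p * r + e =
    M * upper_factor a p * (r + e / (M * upper_factor a p)))%R.
  by rewrite mulrDr [in RHS](mulrC _ (e / _)%R) divfK// gt_eqF.
have A0 : (0 < r + e / (M * upper_factor a p))%R by rewrite ltr_wpDl// divr_gt0.
apply: best; first by rewrite mulr_gt0.
by apply: (rhardy_ineq_upper rad) => //; rewrite AE lee_fin lerDl ltW// divr_gt0.
Qed.

End radial_hardy_theorem.

Theorem theorem2 (R : realType) (n : nat) (hn : (0 < n)%N)
  (p : R) (hp : (1 <= p)%R) (v w : Rn R n -> \bar R)
  (hv : weight (leb R n) v) (hw : weight (leb R n) w)
  (X : BFS (leb R n)) (M : R) (hM : (0 < M)%R)
  (hconv : p_convex X w p M) :
  (forall a : R, (0 < a < 1)%R ->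
    (exists2 C : R, (0 < C)%R & hardy_ineq X p v w C) <->
    hardy_A X p v w a < +oo) /\
  (forall C : R, best_hardy_constant X p v w C ->
    ereal_sup [set (lower_factor a p)%:E * hardy_A X p v w a
                | a in [set a : R | (0 < a < 1)%R]] <= C%:E /\
    C%:E <= M%:E *
      ereal_inf [set (upper_factor a p)%:E * hardy_A X p v w a
                  | a in [set a : R | (0 < a < 1)%R]]).
Proof.
have rad := radial_eucl R hn; split.
  by move=> a a01; exact: (rhardy_iff rad hv hw hp hM hconv a01).
by move=> C [C0 hC best]; exact: (rhardy_best rad hv hw hp hM hconv C0 hC best).
Qed.
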